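(* Let $\mathcal{S}\leq\mathcal{R}$ be discrete, probability measure-preserving equivalence relations on a standard probability space $(X,\mu)$. Then $\mathcal{S}\leq\mathcal{R}$ is a coamenable inclusion if and only if $L^2(X)\preceq L^2(\mathcal{R}/\mathcal{S})$ as representations of $\mathcal{R}$.
   Context: An equivalence relation over a standard probability space $(X,\mu)$ is a Borel subset $\mathcal{R}\subseteq X\times X$ that is an equivalence relation on $X$, with classes $[x]_{\mathcal{R}}$. It is discrete if almost every class is countable; then $\mu_{\mathcal{R}}(E)=\int_X|\{y:(x,y)\in E\}|\,d\mu(x)$ is a $\sigma$-finite measure on $\mathcal{R}$, and $\mathcal{R}$ is probability measure-preserving if $(x,y)\mapsto(y,x)$ preserves $\mu_{\mathcal{R}}$ and $\mu$ is a probability measure. $\mathcal{S}\leq\mathcal{R}$ means $\mathcal{S}\subseteq\mathcal{R}$. $[\mathcal{R}]$ is the group of bimeasurable bijections $\gamma$ of $X$ with $\gamma(x)\in[x]_{\mathcal{R}}$ a.e., modulo a.e. equality. A measurable field of Hilbert spaces over $X$ is a family $(\mathcal{H}_x)_{x\in X}$ of separable Hilbert spaces with a set $\mathrm{Meas}((\mathcal{H}_x)_x)\subseteq\prod_x\mathcal{H}_x$ such that: $x\mapsto\langle\xi_x,\eta_x\rangle$ is measurable for all $\xi,\eta$ in this set; any $\eta\in\prod_x\mathcal{H}_x$ with $x\mapsto\langle\xi_x,\eta_x\rangle$ measurable for all $\xi$ in this set lies in it; it contains a sequence $\xi^{(n)}$ with $\mathcal{H}_x=\overline{\mathrm{span}}\{\xi^{(n)}_x:n\}$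 for a.e. $x$. The direct integral $\int_X^{\oplus}\mathcal{H}_x\,d\mu(x)$ is the Hilbert space of square-integrable measurable sections modulo a.e. equality. A unitary representation of $\mathcal{R}$ is a measurable field $(\mathcal{H}_x)_x$ with unitaries $\pi(x,y)\in\mathcal{U}(\mathcal{H}_y,\mathcal{H}_x)$ for $(x,y)\in\mathcal{R}$, such that $(x,y)\mapsto\langle\pi(x,y)\xi_y,\eta_x\rangle$ is measurable for all measurable sections $\xi,\eta$, and for a.e. $x$, $\pi(x,y)\pi(y,z)=\pi(x,z)$ for all $y,z\in[x]_{\mathcal{R}}$. $L^2(X)=\int_X^\oplus\mathbb{C}\,d\mu(x)$ carries the representation $\alpha(x,y)=\mathrm{id}_{\mathbb{C}}$. Let $[x]_{\mathcal{R}}/\mathcal{S}$ be the set of $\mathcal{S}$-classes contained in $[x]_{\mathcal{R}}$; $(\ell^2([x]_{\mathcal{R}}/\mathcal{S}))_x$ is a measurable field where $\xi$ is measurable iff $x\mapsto\xi_x([\gamma(x)]_{\mathcal{S}})$ is measurable for all $\gamma\in[\mathcal{R}]$. $L^2(\mathcal{R}/\mathcal{S})=\int_X^{\oplus}\ell^2([x]_{\mathcal{R}}/\mathcal{S})\,d\mu(x)$ with the representation $\lambda_{\mathcal{R}/\mathcal{S}}(x,y)=\mathrm{id}$ (note $[x]_{\mathcal{R}}=[y]_{\mathcal{R}}$ for $(x,y)\in\mathcal{R}$). Weak containment: for unitary representations $((\mathcal{H}_x)_x,\pi)$, $((\mathcal{K}_x)_x,\rho)$ of $\mathcal{R}$,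 $\pi\preceq\rho$ if for all measurable $Q\subseteq\mathcal{R}$ with $\mu_{\mathcal{R}}(Q)<\infty$, all measurable sections $\xi$ of $(\mathcal{H}_x)_x$ and all $\varepsilon>0$, there are measurable sections $\zeta_1,\dots,\zeta_k$ of $(\mathcal{K}_x)_x$ with $\mu_{\mathcal{R}}(\{(x,y)\in Q:|\langle\pi(x,y)\xi_y,\xi_x\rangle-\sum_{i=1}^k\langle\rho(x,y)\zeta_{i,y},\zeta_{i,x}\rangle|>\varepsilon\})<\varepsilon$. Coamenability: $\mathcal{S}\leq\mathcal{R}$ is coamenable if there is a sequence $\xi^{(n)}\in L^2(\mathcal{R}/\mathcal{S})$ with $\|\xi^{(n)}_x\|_2=1$ for a.e. $x\in X$ and $\lim_n\|\xi^{(n)}_x-\xi^{(n)}_y\|_2=0$ for a.e. $(x,y)\in\mathcal{R}$. This is equivalent to the inclusion of von Neumann algebras $L(\mathcal{S})\subseteq L(\mathcal{R})$ being relatively amenable (coamenable) in the sense of Popa. *)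

(* Defs.v *)
From HB Require Import structures.
From mathcomp Require Import all_boot all_order all_algebra.
From mathcomp Require Import all_classical all_reals all_analysis.
From mathcomp Require Import finmap complex sesquilinear.
From mathcomp Require Import ring lra.

Set Implicit Arguments.
Unset Strict Implicit.
Unset Printing Implicit Defensive.

Import Order.TTheory GRing.Theory Num.Theory.
Import numFieldNormedType.Exports.

Local Open Scope fset_scope.
Local Open Scope classical_set_scope.
Local Open Scope ring_scope.
Local Open Scope complex_scope.

Section pre_hilbert.
Variables (R : realType) (H : lmodType R[i]) (dot : {dot H for @conjc R}).

Definition dnorm (u : H) : R := Num.sqrt (complex.Re (dot u u)).

Definition dot_complete : Prop := forall u : nat -> H,
  (forall e : R, 0 < e -> exists N : nat, forall m n : nat,
     (N <= m)%N -> (N <= n)%N -> dnorm (u m - u n) < e) ->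
  exists l : H, dnorm (u n - l) @[n --> \oo] --> (0 : R).

End pre_hilbert.

(* Linear in the first argument, conjugate-linear in the second one. *)
Record hilbertSpace (R : realType) := HilbertSpace {
  hilbert_sort :> lmodType R[i];
  hdot : {dot hilbert_sort for @conjc R};
  hilbert_complete : dot_complete hdot
}.
Arguments hdot {R h}.

Definition hnorm (R : realType) (H : hilbertSpace R) (u : H) : R :=
  dnorm hdot u.

Definition sqmod (R : realType) (z : R[i]) : R :=
  complex.Re z ^+ 2 + complex.Im z ^+ 2.

Section sums.
Variables (R : realType) (T : choiceType) (D : set T).
Implicit Types h g p q : T -> R.

(* unconditional sum of an absolutely summable family *)
Definition rsum h : R :=
  fine (\esum_(t in D) ((EFin \o h)^\+)%E t) -
  fine (\esum_(t in D) ((EFin \o h)^\-)%E t).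

Definition csum (f : T -> R[i]) : R[i] :=
  rsum (fun t => complex.Re (f t)) +i* rsum (fun t => complex.Im (f t)).

Local Notation summ h := (summable D (EFin \o h)).

Lemma summP h : summ h <-> (\esum_(t in D) (`|h t|)%:E < +oo)%E.
Proof. by rewrite /summable. Qed.

Lemma summ_le h g : (forall t, D t -> `|h t| <= g t) -> summ g -> summ h.
Proof.
move=> hg; rewrite /summable => /(le_lt_trans _); apply.
apply: le_esum => t Dt /=; rewrite lee_fin.
by rewrite (le_trans (hg _ Dt))// ler_norm.
Qed.

Lemma summD h g : summ h -> summ g -> summ (fun t => h t + g t).
Proof. by move=> ? ?; exact: (@summableD _ _ D (EFin \o h) (EFin \o g)). Qed.

Lemma summN h : summ h -> summ (fun t => - h t).
Proof. by rewrite (@summableN _ _ _ (EFin \o h)). Qed.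

Lemma esumZ (c : R) h : 0 <= c -> (forall t, 0 <= h t) ->
  (\esum_(t in D) (c * h t)%:E = c%:E * \esum_(t in D) (h t)%:E)%E.
Proof.
move=> c0 h0; rewrite /esum -ereal_supZl//; last first.
  by apply/set0P; eexists; exists set0 => //; exact: fsets_set0.
congr ereal_sup; apply/seteqP; split => x /=.
  move=> [A FA <-]; exists (\sum_(t \in A) (h t)%:E)%E; first by exists A.
  by rewrite ge0_mule_fsumr// => t; rewrite lee_fin.
move=> [_ [A FA <-] <-]; exists A => //.
by rewrite ge0_mule_fsumr// => t; rewrite lee_fin.
Qed.

Lemma summZ (c : R) h : summ h -> summ (fun t => c * h t).
Proof.
rewrite !summP => hs.
under eq_esum do rewrite normrM.
by rewrite esumZ// lte_mul_pinfty ?lee_fin// ge0_fin_numE// lee_fin.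
Qed.

Lemma summ_fin h : summ h -> (forall t, 0 <= h t) ->
  (\esum_(t in D) (h t)%:E)%E \is a fin_num.
Proof.
move=> /summP hs h0; rewrite ge0_fin_numE; last first.
  by apply: esum_ge0 => t _; rewrite lee_fin.
apply: le_lt_trans hs; apply: le_esum => t _; rewrite lee_fin ler_norm//.
Qed.

Lemma rsumP h p q : summ p -> summ q -> (forall t, 0 <= p t) ->
  (forall t, 0 <= q t) -> (forall t, D t -> h t = p t - q t) ->
  rsum h = fine (\esum_(t in D) (p t)%:E)%E - fine (\esum_(t in D) (q t)%:E)%E.
Proof.
move=> sp sq p0 q0 hpq.
have sh : summ h.
  have : summ (fun t => p t - q t) by apply: summD => //; exact: summN.
  rewrite !summP; apply: le_lt_trans; apply: le_esum => t Dt.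
  by rewrite hpq.
have fp : ((\esum_(t in D) ((EFin \o h)^\+)%E t)%E \is a fin_num).
  rewrite ge0_fin_numE; last by apply: esum_ge0 => t _; exact: funepos_ge0.
  move: (summable_funepos sh); rewrite /summable.
  by under eq_esum do rewrite gee0_abs ?funepos_ge0//.
have fn : ((\esum_(t in D) ((EFin \o h)^\-)%E t)%E \is a fin_num).
  rewrite ge0_fin_numE; last by apply: esum_ge0 => t _; exact: funeneg_ge0.
  move: (summable_funeneg sh); rewrite /summable.
  by under eq_esum do rewrite gee0_abs ?funeneg_ge0//.
rewrite /rsum -!fineB ?summ_fin//; congr fine.
rewrite -(@esumB _ _ D (EFin \o p) (EFin \o q))//; last 2 first.
- by move=> t _; rewrite lee_fin.
- by move=> t _; rewrite lee_fin.
congr (_ - _)%E; apply: eq_esum => t Dt.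
- by rewrite !funeposE /= hpq.
- by rewrite !funenegE /= hpq.
Qed.

Lemma rsum_ge0E h : summ h -> (forall t, 0 <= h t) ->
  rsum h = fine (\esum_(t in D) (h t)%:E)%E.
Proof.
move=> sh h0; rewrite (@rsumP h h (fun=> 0))//.
- by rewrite [X in _ - fine X]esum1// subr0.
- by rewrite summP; under eq_esum do rewrite normr0; rewrite esum1.
- by move=> t _; rewrite subr0.
Qed.

Let pos h t := Num.max (h t) 0.
Let neg h t := Num.max (- h t) 0.

Let pos_ge0 h t : 0 <= pos h t. Proof. by rewrite le_max lexx orbT. Qed.
Let neg_ge0 h t : 0 <= neg h t. Proof. by rewrite le_max lexx orbT. Qed.

Let pos_neg h t : h t = pos h t - neg h t.
Proof.
rewrite /pos /neg; have [h0|h0] := boolP (0 <= h t).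
  by rewrite max_l// max_r ?subr0// oppr_le0.
move: h0; rewrite -ltNge => h0.
by rewrite max_r ?ltW// max_l ?sub0r ?opprK// oppr_ge0 ltW.
Qed.

Let summ_pos h : summ h -> summ (pos h).
Proof.
rewrite !summP; apply: le_lt_trans; apply: le_esum => t _; rewrite lee_fin.
by rewrite ger0_norm// /pos ge_max ler_norm/=.
Qed.

Let summ_neg h : summ h -> summ (neg h).
Proof.
rewrite !summP; apply: le_lt_trans; apply: le_esum => t _; rewrite lee_fin.
by rewrite ger0_norm// /neg ge_max normr_ge0 andbT -normrN ler_norm.
Qed.

Lemma rsumD h g : summ h -> summ g ->
  rsum (fun t => h t + g t) = rsum h + rsum g.
Proof.
move=> sh sg.
have [sph snh spg sng] :
  [/\ summ (pos h), summ (neg h), summ (pos g) & summ (neg g)].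
  by split; [exact: summ_pos|exact: summ_neg|exact: summ_pos|exact: summ_neg].
rewrite (@rsumP _ (fun t => pos h t + pos g t) (fun t => neg h t + neg g t)).
- rewrite (@rsumP h (pos h) (neg h))// (@rsumP g (pos g) (neg g))//.
  under eq_esum do rewrite EFinD.
  under [X in _ - fine X]eq_esum do rewrite EFinD.
  rewrite !esumD ?fineD ?summ_fin//;
    try by move=> t _; rewrite lee_fin ?pos_ge0 ?neg_ge0.
  by rewrite opprD addrACA.
- exact: summD.
- exact: summD.
- by move=> t; exact: addr_ge0.
- by move=> t; exact: addr_ge0.
- by move=> t _; rewrite {1}(pos_neg h) {1}(pos_neg g) opprD addrACA.
Qed.

Lemma rsumN h : summ h -> rsum (fun t => - h t) = - rsum h.
Proof.
move=> sh; have [sp sn] := (summ_pos sh, summ_neg sh).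
rewrite (@rsumP _ (neg h) (pos h))//.
  by rewrite (@rsumP h (pos h) (neg h))// opprB.
by move=> t _; rewrite {1}(pos_neg h) opprB.
Qed.

Lemma rsumZ (c : R) h : summ h -> rsum (fun t => c * h t) = c * rsum h.
Proof.
wlog c0 : c h / 0 <= c.
  move=> H sh; have [c0|c0] := leP 0 c; first exact: H.
  rewrite -[c in RHS]opprK mulNr -H//; last by rewrite oppr_ge0 ltW.
  rewrite -rsumN; last exact: summZ.
  by congr rsum; apply/funext => t; rewrite mulNr opprK.
move=> sh; have [sp sn] := (summ_pos sh, summ_neg sh).
rewrite (@rsumP h (pos h) (neg h))//.
rewrite (@rsumP _ (fun t => c * pos h t) (fun t => c * neg h t)).
- by rewrite !esumZ// !fineM ?summ_fin// mulrBr.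
- exact: summZ.
- exact: summZ.
- by move=> t; exact: mulr_ge0.
- by move=> t; exact: mulr_ge0.
- by move=> t _; rewrite {1}(pos_neg h) mulrBr.
Qed.

Lemma rsum0 : rsum (fun=> 0) = 0.
Proof.
rewrite rsum_ge0E//; first by rewrite esum1.
by rewrite summP; under eq_esum do rewrite normr0; rewrite esum1.
Qed.

Lemma rsum_ge_term h t : summ h -> (forall t, 0 <= h t) -> D t -> h t <= rsum h.
Proof.
move=> sh h0 Dt; rewrite rsum_ge0E// -lee_fin fineK ?summ_fin//.
apply: esum_ge; exists [set t]; last by rewrite fsbig_set1.
by split => // _ ->.
Qed.

Lemma rsum_le_fin h (e : R) : (forall t, 0 <= h t) ->
  (forall A : {fset T}, [set` A] `<=` D -> \sum_(t <- A) h t <= e) ->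
  summ h /\ rsum h <= e.
Proof.
move=> h0 H.
have le_e : (\esum_(t in D) (h t)%:E <= e%:E)%E.
  apply: ge_ereal_sup => _ [A [finA AD] <-].
  rewrite fsumEFin// lee_fin fsbig_finite//=.
  by apply: H => t /=; rewrite in_fset_set// => /set_mem /AD.
have sh : summ h.
  rewrite summP; under eq_esum do rewrite ger0_norm//.
  exact: le_lt_trans le_e (ltry _).
by split => //; rewrite rsum_ge0E// -lee_fin fineK ?summ_fin.
Qed.

Lemma rsum_ge_fin h (A : {fset T}) : summ h -> (forall t, 0 <= h t) ->
  [set` A] `<=` D -> \sum_(t <- A) h t <= rsum h.
Proof.
move=> sh h0 AD; rewrite rsum_ge0E// -lee_fin fineK ?summ_fin//.
apply: esum_ge; exists [set` A]; first by split.
by rewrite fsumEFin// lee_fin fsbig_finite//= set_fsetK.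
Qed.

End sums.

Section sqmod.
Variable R : realType.
Implicit Types a b : R[i].

Lemma sqmod_ge0 a : 0 <= sqmod a.
Proof. by rewrite addr_ge0 ?sqr_ge0. Qed.

Lemma sqmodE a : (sqmod a)%:C = a * a^*.
Proof. by case: a => x y; simpc; rewrite /sqmod/= !expr2; congr (_ +i* _); ring. Qed.

Lemma sqmodM a b : sqmod (a * b) = sqmod a * sqmod b.
Proof. by case: a => x y; case: b => z t; rewrite /sqmod/=; ring. Qed.

Lemma sqmod_eq0 a : (sqmod a == 0) = (a == 0).
Proof.
by case: a => x y; rewrite /sqmod/= paddr_eq0 ?sqr_ge0// !sqrf_eq0 eq_complex.
Qed.

Lemma sqmodD a b : sqmod (a + b) <= 2 * sqmod a + 2 * sqmod b.
Proof.
case: a b => [x y] [z t]; rewrite /sqmod/=.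
have := sqr_ge0 (x - z); have := sqr_ge0 (y - t); nra.
Qed.

Lemma sqmodB a b : sqmod (a - b) <= 2 * sqmod a + 2 * sqmod b.
Proof.
case: a b => [x y] [z t]; rewrite /sqmod/=.
have := sqr_ge0 (x + z); have := sqr_ge0 (y + t); nra.
Qed.

Lemma Re_mul_conj_le a b : `|complex.Re (a * b^*)| <= sqmod a + sqmod b.
Proof.
case: a b => [x y] [z t]; rewrite /sqmod/= ler_norml.
have := sqr_ge0 (x - z); have := sqr_ge0 (y - t).
have := sqr_ge0 (x + z); have := sqr_ge0 (y + t).
by move=> *; apply/andP; split; nra.
Qed.

Lemma Im_mul_conj_le a b : `|complex.Im (a * b^*)| <= sqmod a + sqmod b.
Proof.
case: a b => [x y] [z t]; rewrite /sqmod/= ler_norml.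
have := sqr_ge0 (x - t); have := sqr_ge0 (y - z).
have := sqr_ge0 (x + t); have := sqr_ge0 (y + z).
by move=> *; apply/andP; split; nra.
Qed.

Lemma sqmod_cauchy (u : nat -> R[i]) :
  (forall e : R, 0 < e -> exists N : nat, forall m n : nat,
     (N <= m)%N -> (N <= n)%N -> sqmod (u m - u n) < e) ->
  exists l, sqmod (u n - l) @[n --> \oo] --> (0 : R).
Proof.
move=> cu.
have real_cauchy (v : nat -> R) :
    (forall m n, (v m - v n) ^+ 2 <= sqmod (u m - u n)) ->
    cvg (v @ \oo).
  move=> vu; apply/cauchy_cvgP/cauchyP => e e0.
  have [N hN] := cu _ (exprn_gt0 2 e0).
  exists (v N); exists N => // n /= Nn.
  rewrite /ball/= -(@ltr_pXn2r _ 2) ?nnegrE ?normr_ge0 ?(ltW e0)//.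
  rewrite real_normK ?num_real//.
  exact: le_lt_trans (vu _ _) (hN _ _ (leqnn _) Nn).
pose x n := complex.Re (u n); pose y n := complex.Im (u n).
have cx : cvg (x @ \oo).
  by apply: real_cauchy => m n; rewrite /x; case: (u m) (u n) => [a b] [c d];
    rewrite /sqmod/= lerDl sqr_ge0.
have cy : cvg (y @ \oo).
  by apply: real_cauchy => m n; rewrite /y; case: (u m) (u n) => [a b] [c d];
    rewrite /sqmod/= lerDr sqr_ge0.
pose a := lim (x @ \oo); pose b := lim (y @ \oo).
exists (a +i* b).
rewrite (_ : (fun n => _) =
    fun n => (x n - a) * (x n - a) + (y n - b) * (y n - b)); last first.
  by apply/funext => n /=; rewrite /sqmod /x /y -!expr2; case: (u n).
rewrite (_ : (0 : R) = (a - a) * (a - a) + (b - b) * (b - b)); last first.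
  by rewrite !subrr mul0r addr0.
by apply: cvgD; apply: cvgM; apply: cvgB => //; exact: cvg_cst.
Qed.

End sqmod.

Section ell2.
Variables (R : realType) (T : choiceType) (D : set T).

(* the Hilbert space $\ell^2(D)$, realized as functions on T vanishing off D *)
Definition ell2_pred : {pred T -> R[i]} := fun f =>
  `[< (forall t, ~ D t -> f t = 0) /\
      summable D (EFin \o (fun t => sqmod (f t))) >].

Record ell2 := Ell2 { ell2_fun :> T -> R[i] ; ell2P : ell2_fun \in ell2_pred }.

HB.instance Definition _ := [isSub for ell2_fun].
HB.instance Definition _ := [Choice of ell2 by <:].

Lemma ell2_submod_closed : submod_closed ell2_pred.
Proof.
split.
  apply/asboolP; split=> //=; apply/summP.
  by rewrite esum1// => t _; rewrite /= /sqmod/= expr0n addr0 normr0.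
move=> a f g /asboolP[f0 sf] /asboolP[g0 sg]; apply/asboolP; split => [t Dt|].
  by rewrite -[LHS]/(a *: f t + g t) f0// g0// scaler0 addr0.
apply: (@summ_le _ _ _ _ (fun t => 2 * sqmod a * sqmod (f t) + 2 * sqmod (g t))).
  move=> t _; rewrite ger0_norm ?sqmod_ge0//.
  rewrite -[(_ + _) t]/(a * f t + g t).
  rewrite -mulrA -sqmodM; exact: sqmodD.
by apply: summD; exact: summZ.
Qed.

HB.instance Definition _ := GRing.isSubmodClosed.Build _ _ ell2_pred
  ell2_submod_closed.
HB.instance Definition _ := [SubChoice_isSubLmodule of ell2 by <:].

Definition ell2_dot (f g : ell2) : R[i] := csum D (fun t => f t * (g t)^*).

Lemma ell2_out (f : ell2) t : ~ D t -> f t = 0.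
Proof. by have /asboolP[+ _] := ell2P f; apply. Qed.

Lemma ell2_summ (f : ell2) : summable D (EFin \o (fun t => sqmod (f t))).
Proof. by have /asboolP[] := ell2P f. Qed.

Let summRe (f g : ell2) :
  summable D (EFin \o (fun t => complex.Re (f t * (g t)^*))).
Proof.
apply: (@summ_le _ _ _ _ (fun t => sqmod (f t) + sqmod (g t))).
  by move=> t _; exact: Re_mul_conj_le.
by apply: summD; exact: ell2_summ.
Qed.

Let summIm (f g : ell2) :
  summable D (EFin \o (fun t => complex.Im (f t * (g t)^*))).
Proof.
apply: (@summ_le _ _ _ _ (fun t => sqmod (f t) + sqmod (g t))).
  by move=> t _; exact: Im_mul_conj_le.
by apply: summD; exact: ell2_summ.
Qed.

Let ell2_hermitian (f g : ell2) :
  ell2_dot f g = (-1) ^+ false * (ell2_dot g f)^*.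
Proof.
rewrite expr0 mul1r /ell2_dot /csum; congr (_ +i* _).
  by congr rsum; apply/funext => t; case: (f t) (g t) => [a b] [c d] /=; ring.
rewrite -rsumN//.
by congr rsum; apply/funext => t; case: (f t) (g t) => [a b] [c d] /=; ring.
Qed.

Let ell2_linearl (g : ell2) : GRing.linear_for *%R (ell2_dot ^~ g).
Proof.
move=> a f1 f2; rewrite /ell2_dot /csum.
case: a => a b.
have E t : ell2_fun ((a +i* b) *: f1 + f2) t = (a +i* b) * f1 t + f2 t by [].
simpc; congr (_ +i* _).
  rewrite -!(rsumZ (D := D))// -rsumN; last exact: summZ.
  rewrite -!rsumD//; last 3 first.
  - by apply: summD; [exact: summZ|apply: summN; exact: summZ].
  - exact: summZ.
  - by apply: summN; exact: summZ.
  congr rsum; apply/funext => t.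
  rewrite E.
  by case: (f1 t) (f2 t) (g t) => [? ?] [? ?] [? ?] /=; ring.
rewrite -!(rsumZ (D := D))// -!rsumD//.
- congr rsum; apply/funext => t.
  rewrite E.
  by case: (f1 t) (f2 t) (g t) => [? ?] [? ?] [? ?] /=; ring.
- by apply: summD; exact: summZ.
- exact: summZ.
- exact: summZ.
Qed.

Let ell2_linearr (f : ell2) : GRing.linear_for (@conjc R \; *%R) (ell2_dot f).
Proof.
move=> a g1 g2; rewrite /= ell2_hermitian ell2_linearl expr0 mul1r.
by rewrite rmorphD rmorphM [in RHS]ell2_hermitian [ell2_dot f g2]ell2_hermitian
  expr0 !mul1r.
Qed.

HB.instance Definition _ := bilinear_isBilinear.Build R[i] ell2 ell2 R[i]
  *%R (@conjc R \; *%R) ell2_dot (ell2_linearl, ell2_linearr).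
HB.instance Definition _ := isHermitianSesquilinear.Build R[i] ell2 false
  (@conjc R) ell2_dot ell2_hermitian.

Lemma ell2_dotE (f : ell2) :
  ell2_dot f f = (rsum D (fun t => sqmod (f t)))%:C.
Proof.
rewrite /ell2_dot /csum; congr (_ +i* _).
  by congr rsum; apply/funext => t; rewrite -sqmodE.
rewrite -[RHS](rsum0 R D).
by congr rsum; apply/funext => t; rewrite -sqmodE.
Qed.

Let ell2_dot_gt0 (f : ell2) : f != 0 -> 0 < ell2_dot f f.
Proof.
move=> f0; rewrite ell2_dotE ltcR.
have [t ft] : exists t, f t != 0.
  apply: contrapT => /forallNP H; move/eqP: f0; apply; apply/val_inj/funext => t.
  by apply/eqP/negPn/negP/H.
have Dt : D t by apply: contrapT => /(ell2_out f) ft0; rewrite ft0 eqxx in ft.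
apply: (@lt_le_trans _ _ (sqmod (f t))).
  by rewrite lt0r sqmod_ge0 sqmod_eq0 ft.
by apply: (@rsum_ge_term _ _ _ (fun t => sqmod (f t))) => //;
  [exact: ell2_summ|move=> ?; exact: sqmod_ge0].
Qed.

HB.instance Definition _ := isDotProduct.Build R[i] ell2 ell2_dot ell2_dot_gt0.

Let dnormE (f : ell2) : dnorm ell2_dot f ^+ 2 = rsum D (fun t => sqmod (f t)).
Proof.
rewrite /dnorm -[X in complex.Re X]/(ell2_dot f f) ell2_dotE/= sqr_sqrtr//.
rewrite rsum_ge0E ?fine_ge0//.
- by apply: esum_ge0 => t _; rewrite lee_fin sqmod_ge0.
- exact: ell2_summ.
- by move=> t; exact: sqmod_ge0.
Qed.

Let dnorm_ge0 (f : ell2) : 0 <= dnorm ell2_dot f.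
Proof. exact: sqrtr_ge0. Qed.

Lemma ell2_complete : dot_complete (ell2_dot : {dot ell2 for @conjc R}).
Proof.
move=> u cu.
have cu2 (e : R) : 0 < e -> exists N : nat, forall m n : nat,
    (N <= m)%N -> (N <= n)%N -> forall A : {fset T}, [set` A] `<=` D ->
    \sum_(t <- A) sqmod (u m t - u n t) < e.
  move=> e0; have := cu (Num.sqrt e); rewrite sqrtr_gt0 => /(_ e0)[N hN].
  exists N => m n Nm Nn A AD.
  apply: (@le_lt_trans _ _ (rsum D (fun t => sqmod ((u m - u n) t)))).
    apply: (@rsum_ge_fin _ _ _ (fun t => sqmod ((u m - u n) t)) A) => //.
      exact: ell2_summ.
    by move=> t; exact: sqmod_ge0.
  rewrite -dnormE -[ltRHS]sqr_sqrtr ?ltW//.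
  by rewrite ltr_pXn2r ?nnegrE ?sqrtr_ge0// hN.
have /choice[f hf] t : exists l, (~ D t -> l = 0) /\
    sqmod (u n t - l) @[n --> \oo] --> (0 : R).
  have [Dt|Dt] := pselect (D t); last first.
    exists 0; split => //.
    rewrite (_ : (fun n => _) = fun=> 0); first exact: cvg_cst.
    by apply/funext => n; rewrite ell2_out// subr0 /sqmod/= expr0n addr0.
  have [|l hl] := @sqmod_cauchy _ (fun n => u n t); last by exists l; split.
  move=> e e0; have [N hN] := cu2 _ e0; exists N => m n Nm Nn.
  have := hN _ _ Nm Nn [fset t]%fset; rewrite big_seq_fset1; apply.
  by move=> s /=; rewrite inE => /eqP ->.
have uf (e : R) : 0 < e -> exists N : nat, forall n : nat, (N <= n)%N ->
    forall A : {fset T}, [set` A] `<=` D -> \sum_(t <- A) sqmod (u n t - f t) <= e.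
  move=> e0; have [|N hN] := cu2 (e / 4); first by rewrite divr_gt0.
  exists N => n Nn A AD.
  have H : \sum_(t <- A) sqmod (u m t - f t) @[m --> \oo] --> (0 : R).
    elim: (A : seq T) => [|t s IHs].
      by under eq_cvg do [rewrite big_nil]; exact: cvg_cst.
    have := cvgD (hf t).2 IHs; rewrite addr0 => H.
    apply: cvg_trans (H _); apply: near_eq_cvg.
    by apply: nearW => m /=; rewrite big_cons.
  have {}H : \forall m \near \oo, \sum_(t <- A) sqmod (u m t - f t) < e / 4.
    by apply: (cvgr_lt 0 H); rewrite divr_gt0.
  near \oo => m.
  have Nm : (N <= m)%N by near: m; exists N.
  have h1 := hN _ _ Nn Nm _ AD.
  have h2 : \sum_(t <- A) sqmod (u m t - f t) < e / 4 by near: m.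
  apply: (@le_trans _ _ (2 * \sum_(t <- A) sqmod (u n t - u m t) +
     2 * \sum_(t <- A) sqmod (u m t - f t))); last by lra.
  rewrite !mulr_sumr -big_split/=; apply: ler_sum => t _.
  by rewrite (le_trans _ (sqmodD _ _))// addrA subrK.
have uf_in n0 (e : R) : (forall A : {fset T}, [set` A] `<=` D ->
    \sum_(t <- A) sqmod (u n0 t - f t) <= e) -> (fun t => u n0 t - f t) \in ell2_pred.
  move=> H; apply/asboolP; split.
    by move=> t Dt; rewrite ell2_out// (hf t).1// subr0.
  by have [] := @rsum_le_fin _ _ D (fun t => sqmod (u n0 t - f t)) e
    (fun t => sqmod_ge0 _) H.
have [N1 hN1] := uf 1 ltr01.
pose l : ell2 := u N1 - Ell2 (uf_in _ _ (hN1 N1 (leqnn _))).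
have lE t : l t = f t by rewrite -[LHS]/(u N1 t - (u N1 t - f t)) subKr.
exists l; apply/cvgrPdist_le => e e0.
have [N hN] := uf _ (exprn_gt0 2 e0).
exists N => // n /= Nn; rewrite sub0r normrN ger0_norm//.
rewrite -(@ler_pXn2r _ 2) ?nnegrE ?(ltW e0)// dnormE.
rewrite (_ : (fun t => _) = fun t => sqmod (u n t - f t)); last first.
  by apply/funext => t; rewrite -lE.
by have [] := @rsum_le_fin _ _ D (fun t => sqmod (u n t - f t)) (e ^+ 2)
    (fun t => sqmod_ge0 _) (hN n Nn).
Unshelve. all: by end_near. Qed.

Definition ell2_space : hilbertSpace R := HilbertSpace ell2_complete.

End ell2.

Section scalars.
Variable R : realType.

Definition scalar_dot (a b : R[i]^o) : R[i] := a * b^*.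

Let scalar_hermitian (a b : R[i]^o) :
  scalar_dot a b = (-1) ^+ false * (scalar_dot b a)^*.
Proof.
rewrite /scalar_dot expr0 mul1r.
by case: a b => [x y] [z t]; simpc; congr (_ +i* _); ring.
Qed.

Let scalar_linearl (b : R[i]^o) : GRing.linear_for *%R (scalar_dot ^~ b).
Proof. by move=> k a1 a2; rewrite /scalar_dot mulrDl -mulrA. Qed.

Let scalar_linearr (a : R[i]^o) :
  GRing.linear_for (@conjc R \; *%R) (scalar_dot a).
Proof.
move=> k b1 b2; rewrite /scalar_dot rmorphD mulrDr; congr (_ + _).
by rewrite [_ *: _]/(k * b1) rmorphM mulrCA.
Qed.

HB.instance Definition _ := bilinear_isBilinear.Build R[i] R[i]^o R[i]^o R[i]
  *%R (@conjc R \; *%R) scalar_dot (scalar_linearl, scalar_linearr).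
HB.instance Definition _ := isHermitianSesquilinear.Build R[i] R[i]^o false
  (@conjc R) scalar_dot scalar_hermitian.

Let scalar_dot_gt0 (a : R[i]^o) : a != 0 -> 0 < scalar_dot a a.
Proof.
by move=> a0; rewrite /scalar_dot -sqmodE ltcR lt0r sqmod_ge0 sqmod_eq0 a0.
Qed.

HB.instance Definition _ :=
  isDotProduct.Build R[i] R[i]^o scalar_dot scalar_dot_gt0.

Lemma scalar_complete : dot_complete (scalar_dot : {dot R[i]^o for @conjc R}).
Proof.
have dE (a : R[i]) : dnorm scalar_dot a = Num.sqrt (sqmod a).
  by rewrite /dnorm -[X in complex.Re X]/(a * a^*) -sqmodE.
move=> u cu; have [|l hl] := @sqmod_cauchy R u.
  move=> e e0; have := cu (Num.sqrt e); rewrite sqrtr_gt0 => /(_ e0)[N hN].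
  exists N => m n Nm Nn; have := hN m n Nm Nn.
  by rewrite dE ltr_sqrt.
exists l; apply/cvgrPdist_lt => e e0.
have : \forall n \near \oo, sqmod (u n - l) < e ^+ 2.
  by apply: (cvgr_lt _ hl); rewrite exprn_gt0.
apply: filterS => n hn.
rewrite sub0r normrN dE ger0_norm ?sqrtr_ge0//.
by rewrite -(ger0_norm (ltW e0)) -sqrtr_sqr ltr_sqrt// exprn_gt0.
Qed.

Definition scalar_space : hilbertSpace R := HilbertSpace scalar_complete.

End scalars.

Section relations.
Variables (d : measure_display) (X : measurableType d) (R : realType).
Implicit Types (Rel S E : set (X * X)).

(* X is isomorphic, as a measurable space, to a Polish space with its Borel
   sigma-algebra. *)
Definition standard_borel : Prop :=
  exists (P : completePseudoMetricType R) (f : X -> P),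
    [/\ hausdorff_space P, @second_countable P, bijective f &
        forall A : set X, measurable A <->
          exists2 B : set P, <<s open >> B & A = f @^-1` B].

Variable mu : probability X R.

Definition relclass E (x : X) : set X := [set y | E (x, y)].

(* If x |-> #|E_x| is only measurable off a null set, this is still the
   expected value: the integral of a nonnegative function is a supremum over
   the simple functions below it. *)
Definition rel_measure E : \bar R := (\int[mu]_x counting (relclass E x))%E.

Record pmp_relation Rel : Prop := PmpRelation {
  rel_measurable : measurable Rel;
  rel_refl : forall x, Rel (x, x);
  rel_sym : forall x y, Rel (x, y) -> Rel (y, x);
  rel_trans : forall x y z, Rel (x, y) -> Rel (y, z) -> Rel (x, z);
  rel_discrete : {ae mu, forall x, countable (relclass Rel x)};
  rel_pmp : forall E, measurable E -> E `<=` Rel ->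
    rel_measure [set z | E (z.2, z.1)] = rel_measure E
}.

Definition full_group Rel (gamma : X -> X) : Prop :=
  [/\ measurable_fun setT gamma,
      exists2 delta : X -> X, measurable_fun setT delta &
        cancel gamma delta /\ cancel delta gamma
    & {ae mu, forall x, Rel (x, gamma x)}].

End relations.

Definition complex_measurable d (T : measurableType d) (R : realType)
    (f : T -> R[i]) : Prop :=
  measurable_fun setT (fun t => complex.Re (f t)) /\
  measurable_fun setT (fun t => complex.Im (f t)).

(* Measurability up to null sets.  This is the notion that is compatible with
   elements of the full group being given modulo a.e. equality. *)
Definition ae_measurable d (T : measurableType d) (R : realType)
    (mu : set T -> \bar R) (f : T -> R[i]) : Prop :=
  exists2 g : T -> R[i], complex_measurable g & {ae mu, forall t, f t = g t}.

Record hilbertField (X : Type) (R : realType) := HilbertField {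
  fibre :> X -> hilbertSpace R;
  meas_section : set (forall x, fibre x)
}.
Arguments meas_section {X R} h.

Section fields_and_representations.
Variables (d : measure_display) (X : measurableType d) (R : realType).
Variable mu : probability X R.

(* Separability of almost every fibre is part of the third axiom. *)
Record measurable_field (H : hilbertField X R) : Prop := MeasurableField {
  field_dot_measurable : forall xi eta : forall x, H x,
    meas_section H xi -> meas_section H eta ->
    ae_measurable mu (fun x => hdot (xi x) (eta x));
  field_saturated : forall eta : forall x, H x,
    (forall xi, meas_section H xi -> ae_measurable mu (fun x => hdot (xi x) (eta x))) ->
    meas_section H eta;
  field_total : exists xi : nat -> forall x, H x,
    (forall n, meas_section H (xi n)) /\
    {ae mu, forall x, forall (u : H x) (e : R), 0 < e ->
       exists (N : nat) (c : 'I_N -> R[i]),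
         hnorm (u - \sum_(n < N) c n *: xi n x) < e}
}.

(* The direct integral is the set of these sections modulo a.e. equality. *)
Definition L2_section (H : hilbertField X R) (xi : forall x, H x) : Prop :=
  meas_section H xi /\ (\int[mu]_x (hnorm (xi x) ^+ 2)%:E < +oo)%E.

Definition unitary_map (H K : hilbertSpace R) (U : H -> K) : Prop :=
  [/\ linear U, forall u v, hdot (U u) (U v) = hdot u v & range U = setT].

Record representation (Rel : set (X * X)) := Representation {
  rep_field :> hilbertField X R;
  rep_map : forall x y, Rel (x, y) -> rep_field y -> rep_field x;
  rep_unitary : forall x y (xy : Rel (x, y)), unitary_map (rep_map xy);
  rep_cocycle : {ae mu, forall x, forall y z
    (xy : Rel (x, y)) (yz : Rel (y, z)) (xz : Rel (x, z)) (u : rep_field z),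
    rep_map xy (rep_map yz u) = rep_map xz u}
}.

(* The measurability axioms of a unitary representation.  They are kept apart
   from the record since weak containment only depends on the data. *)
Record measurable_representation Rel (pi : representation Rel) : Prop :=
  MeasurableRepresentation {
    rep_measurable_field : measurable_field pi;
    rep_coef_measurable : forall xi eta : forall x, pi x,
      meas_section pi xi -> meas_section pi eta ->
      exists2 g : X * X -> R[i], complex_measurable g &
        {ae rel_measure mu, forall z, forall xy : Rel (z.1, z.2),
          hdot (rep_map xy (xi z.2)) (eta z.1) = g z}
}.

Definition weakly_contained Rel (pi rho : representation Rel) : Prop :=
  forall Q : set (X * X), measurable Q -> Q `<=` Rel ->
    (rel_measure mu Q < +oo)%E ->
  forall xi : forall x, pi x, meas_section pi xi ->
  forall e : R, 0 < e ->
  exists (k : nat) (zeta : 'I_k -> forall x, rho x),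
    (forall i, meas_section rho (zeta i)) /\
    (rel_measure mu [set z | Q z /\ exists xy : Rel (z.1, z.2),
       (e%:C < `| hdot (rep_map xy (xi z.2)) (xi z.1) -
                  \sum_(i < k) hdot (rep_map xy (zeta i z.2)) (zeta i z.1) |)%R]
     < e%:E)%E.

Definition scalar_field : hilbertField X R :=
  HilbertField [set xi : X -> scalar_space R | ae_measurable mu xi].

Lemma unitary_map_id (H : hilbertSpace R) : unitary_map (@id H).
Proof.
split=> //.
by apply/seteqP; split => // u _; exists u.
Qed.

(* $L^2(X)$ with $\alpha(x,y) = \mathrm{id}$ *)
Definition scalar_rep (Rel : set (X * X)) : representation Rel :=
  @Representation Rel scalar_field (fun _ _ _ u => u)
    (fun _ _ _ => unitary_map_id _) (aeW mu (fun _ _ _ _ _ _ _ => erefl)).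

Definition quotient (Rel S : set (X * X)) (x : X) : set (set X) :=
  [set relclass S y | y in relclass Rel x].

Definition quotient_field (Rel S : set (X * X)) : hilbertField X R :=
  @HilbertField X R (fun x => ell2_space R (quotient Rel S x))
    [set xi : forall x, ell2 R (quotient Rel S x) |
       forall gamma, full_group mu Rel gamma ->
         ae_measurable mu (fun x => xi x (relclass S (gamma x)))].

Lemma quotient_eq Rel S x y : pmp_relation mu Rel -> Rel (x, y) ->
  quotient Rel S y = quotient Rel S x.
Proof.
move=> hR xy; congr image; apply/seteqP; split => z /= h.
- exact: (rel_trans hR xy h).
- exact: (rel_trans hR (rel_sym hR xy) h).
Qed.

Lemma ell2_castP (T : choiceType) (D E : set T) (f : ell2 R D) :
  D = E -> (f : T -> R[i]) \in @ell2_pred R T E.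
Proof. by move=> <-; exact: ell2P. Qed.

(* the identity of $\ell^2(D)$ when D and E are the same set *)
Definition ell2_cast (T : choiceType) (D E : set T) (DE : D = E)
    (f : ell2 R D) : ell2 R E := Ell2 (ell2_castP f DE).

Lemma ell2_cast_unitary (T : choiceType) (D E : set T) (DE : D = E) :
  @unitary_map (ell2_space R D) (ell2_space R E) (ell2_cast DE).
Proof.
case: E / DE; have castE f : ell2_cast (erefl D) f = f by exact: val_inj.
split.
- by move=> a u v; rewrite !castE.
- by move=> u v; rewrite !castE.
- by apply/seteqP; split => // u _; exists u; rewrite ?castE.
Qed.

Definition quotient_map Rel S (hR : pmp_relation mu Rel) x y
    (xy : Rel (x, y)) : quotient_field Rel S y -> quotient_field Rel S x :=
  ell2_cast (quotient_eq S hR xy).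

Lemma quotient_map_cocycle Rel S (hR : pmp_relation mu Rel) x y z
    (xy : Rel (x, y)) (yz : Rel (y, z)) (xz : Rel (x, z)) u :
  quotient_map (S := S) hR xy (quotient_map hR yz u) = quotient_map hR xz u.
Proof. exact: val_inj. Qed.

(* $L^2(\mathcal R/\mathcal S)$ with $\lambda_{\mathcal R/\mathcal S}$ *)
Definition quotient_rep Rel S (hR : pmp_relation mu Rel) : representation Rel :=
  @Representation Rel (quotient_field Rel S) (quotient_map hR)
    (fun x y xy => ell2_cast_unitary (quotient_eq S hR xy))
    (aeW mu (quotient_map_cocycle hR)).

Definition coamenable Rel S (hR : pmp_relation mu Rel) : Prop :=
  exists xi : nat -> forall x, quotient_field Rel S x,
    [/\ forall n, L2_section (xi n),
        forall n, {ae mu, forall x, hnorm (xi n x) = 1}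
      & {ae rel_measure mu, forall z, forall xy : Rel (z.1, z.2),
          hnorm (xi n z.1 - quotient_map hR xy (xi n z.2)) @[n --> \oo]
            --> (0 : R)}].

End fields_and_representations.

Arguments scalar_rep {d X R} mu Rel.
Arguments quotient_rep {d X R mu Rel} S hR.
Arguments coamenable {d X R mu Rel} S hR.

(* Main.v *)
Require Import Defs.
From mathcomp Require Import all_boot all_order all_algebra.
From mathcomp Require Import all_classical all_reals all_analysis.
From mathcomp Require Import measurable_realfun.
From mathcomp Require Import complex sesquilinear.
From mathcomp Require Import ring lra.

(** Write R for the ambient relation and S for the smaller one.

    From coamenability to weak containment, let xi^n be almost invariant unit
    sections of l^2([x]_R / S) and let f be a section of the trivial field.
    The single section f xi^n has the coefficient
    f(y) f(x)^* <xi^n_y, xi^n_x>, and Cauchy-Schwarz bounds its distance to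
    f(y) f(x)^* by |f(y) f(x)| |xi^n_x - xi^n_y|, which tends to 0 almost
    everywhere.  On a set Q of finite measure this gives convergence in measure
    ([coamenable_weakly_contained]).

    From weak containment to coamenability, approximate the constant
    coefficient 1 within e on a set Q that contains the diagonal.  This gives
    sections zeta_1, ..., zeta_k such that H(x) = sum_i |zeta_i,x|^2 is close
    to 1 and sum_i |zeta_i,x - zeta_i,y|^2 = H(x) + H(y) - 2 Re sum_i
    <zeta_i,y, zeta_i,x> is small.  The k sections are merged into one:
    xi_x(c) = (sum_i |zeta_i,x(c)|^2 / H(x))^(1/2) is a unit vector, and the
    triangle inequality in C^k shows that merging does not increase distances
    ([hnorm_ell2_rootB]).  Taking e = 2^-m / 8 for the m-th step, with sets Q
    that exhaust R, the Borel-Cantelli lemma makes the error tend to 0 almost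
    everywhere ([weakly_contained_coamenable]).

    Both arguments manipulate measurability and null sets on R as if R were the
    union of countably many copies of X.  This is the Feldman-Moore theorem
    ([feldman_moore]): up to a null set, R is the union of the graphs of
    countably many measurable involutions g_n of X.  It makes R sigma-finite,
    turns the norm of a section into the countable sum of the functions
    |xi_x([g_n x])|^2 over representatives of the S-classes
    ([hnorm2_series]), and reduces statements about almost every (x, y) in R
    to statements about almost every x and every n.

    The Feldman-Moore theorem rests on a selection theorem of Lusin-Novikov
    type ([thin_of_countable_sections]): a measurable set with countable
    sections is covered, over almost every x, by countably many graphs of
    measurable maps.  The set is written as the result of a Souslin operation
    on rectangles, so that it is a union of branches indexed by the finite
    sequences s.  Over each branch, let B_s be the set of base points above
    which the branch cannot be covered.  Almost every x in B_s sees two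
    disjoint sub-branches that cannot be covered either, since otherwise what
    remains of the branch is the graph of a limit of measurable maps
    ([support_splits]).  If the root of the tree could not be covered, one
    could follow, for a single x, a branch that avoids any given sequence of
    points, and the section at x would be uncountable
    ([splitting_uncountable]).  Null sets can be discarded throughout, so that
    no projection of a measurable set has to be shown measurable. *)

Set Implicit Arguments.
Unset Strict Implicit.
Unset Printing Implicit Defensive.

Import Order.TTheory GRing.Theory Num.Theory.
Import numFieldNormedType.Exports.

Local Open Scope classical_set_scope.
Local Open Scope ring_scope.

(** * Souslin representation of measurable sets *)

Section dense_sequence.
Variables (R : realType) (P : pseudoMetricType R) (p0 : P).
Hypothesis scP : @second_countable P.

Lemma second_countable_dense : exists c : nat -> P,
  forall p (e : R), 0 < e -> exists n, ball (c n) e p.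
Proof.
case: scP => B /countable_injP[f finj] [_ Bbasis].
have /choice[c hc] n : exists q, forall U, B U -> f U = n -> forall p, U p -> U q.
  have [[U [BU fU [q Uq]]]|H] := pselect (exists U, [/\ B U, f U = n & U !=set0]).
    exists q => V BV fV p Vp.
    by have -> : V = U by apply: finj; [exact: mem_set|exact: mem_set|rewrite fV].
  by exists p0 => U BU fU p Up; exfalso; apply: H; exists U; split => //; exists p.
exists c => p e e0.
have [U [BU Up] Ue] := Bbasis p _ (nbhsx_ballx p e e0).
exists (f U); apply: ball_sym; apply: Ue; exact: (hc _ _ BU erefl p Up).
Qed.

End dense_sequence.

Section souslin.
Variables (R : realType) (d : measure_display) (X : measurableType d).
Variables (P : completePseudoMetricType R) (phi : X -> P).

(** The second factor is read through [phi], which identifies X with a Polish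
    space: the first coordinate only needs measurable sets, the second one
    closed sets, because a branch has to be followed to a limit point there. *)
Definition souslin (E : set (X * X)) := exists (D : seq nat -> set X)
    (K : seq nat -> set P),
  [/\ forall s, measurable (D s), forall s, closed (K s) &
      forall z, E z <-> exists u : nat -> nat, forall n,
        D (mkseq u n) z.1 /\ K (mkseq u n) (phi z.2)].

Lemma souslin_rect (A : set X) (C : set P) : measurable A -> closed C ->
  souslin [set z | A z.1 /\ C (phi z.2)].
Proof.
move=> mA cC; exists (fun=> A), (fun=> C); split => // z; split.
  by move=> h; exists (fun=> 0%N).
by move=> [u /(_ 0%N)].
Qed.

Lemma mkseq_behead (T : Type) (u : nat -> T) n :
  mkseq u n.+1 = u 0%N :: mkseq (u \o S) n.
Proof. by rewrite /mkseq/= (iotaDl 1 0) -map_comp. Qed.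

Lemma souslin_bigcup (F : nat -> set (X * X)) :
  (forall i, souslin (F i)) -> souslin (\bigcup_i F i).
Proof.
move=> /choice[D] /choice[K] hDK.
exists (fun s => if s is i :: t then D i t else setT).
exists (fun s => if s is i :: t then K i t else setT); split.
- by case=> [|i t]; [exact: measurableT|have [] := hDK i].
- by case=> [|i t]; [exact: closedT|have [] := hDK i].
move=> z; split.
  move=> [i _ Fz]; have [_ _ /(_ z)[/(_ Fz)[u hu] _]] := hDK i.
  exists (fun n => if n is m.+1 then u m else i); case => [//|n].
  rewrite mkseq_behead/=; exact: hu.
move=> [u hu]; exists (u 0%N) => //.
have [_ _ /(_ z)[_]] := hDK (u 0%N); apply; exists (u \o S) => n.
by have := hu n.+1; rewrite mkseq_behead.
Qed.

(** The bijection between pairs and positive integers given by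
    2^i (2j + 1).  It is increasing in j, so that the first n terms of a
    sequence determine the first m terms of its i-th row when n = npair i m. *)
Definition npair (i j : nat) : nat := (2 ^ i * j.*2.+1)%N.

Definition nunpair (n : nat) : nat * nat :=
  (logn 2 n, (n %/ 2 ^ logn 2 n)./2).

Lemma npairK i j : nunpair (npair i j) = (i, j).
Proof.
have E : logn 2 (npair i j) = i.
  rewrite /npair lognM ?expn_gt0// pfactorK// logn_coprime ?addn0//.
  by rewrite coprime2n /= odd_double.
by rewrite /nunpair E /npair mulKn ?expn_gt0//= uphalf_double.
Qed.

Lemma nunpair_lt n j : (j < (nunpair n).2)%N -> (npair (nunpair n).1 j < n)%N.
Proof.
case: n => [//|n].
rewrite /nunpair /npair /= => jn.
set k := logn 2 n.+1 in jn *.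
have nE : (n.+1 %/ 2 ^ k * 2 ^ k)%N = n.+1.
  by apply: divnK; exact: pfactor_dvdnn.
rewrite -[ltnRHS]nE mulnC ltn_pmul2r ?expn_gt0//.
set q := (n.+1 %/ 2 ^ k)%N in jn *.
apply: (@leq_trans q./2.*2); last by rewrite -[leqRHS]odd_double_half leq_addl.
by rewrite -doubleS leq_double.
Qed.

(** One sequence u codes a whole sequence of witnesses, its rows.  The
    condition at level n = npair i m is the condition at level m on row i, so
    that every level carries exactly one condition. *)
Lemma souslin_bigcap (F : nat -> set (X * X)) :
  (forall i, souslin (F i)) -> souslin (\bigcap_i F i).
Proof.
move=> /choice[D] /choice[K] hDK.
pose sub s := mkseq (fun j => nth 0%N s (npair (nunpair (size s)).1 j))
                    (nunpair (size s)).2.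
have subE u n : sub (mkseq u n) =
    mkseq (fun j => u (npair (nunpair n).1 j)) (nunpair n).2.
  rewrite /sub size_mkseq; apply/eq_in_map => j.
  by rewrite mem_iota => /andP[_ /nunpair_lt jn]; rewrite nth_mkseq.
exists (fun s => D (nunpair (size s)).1 (sub s)).
exists (fun s => K (nunpair (size s)).1 (sub s)); split.
- by move=> s; have [] := hDK (nunpair (size s)).1.
- by move=> s; have [] := hDK (nunpair (size s)).1.
move=> z; split.
  move=> Fz; have /choice[u hu] i : exists u : nat -> nat, forall n,
      D i (mkseq u n) z.1 /\ K i (mkseq u n) (phi z.2).
    by have [_ _ /(_ z)[+ _]] := hDK i; apply; exact: Fz.
  exists (fun n => u (nunpair n).1 (nunpair n).2) => n.
  rewrite subE size_mkseq.
  rewrite (_ : mkseq _ _ = mkseq (u (nunpair n).1) (nunpair n).2)//.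
  by apply: eq_map => j; rewrite npairK.
move=> [u hu] i _; have [_ _ /(_ z)[_]] := hDK i; apply.
exists (fun j => u (npair i j)) => m.
by have := hu (npair i m); rewrite subE size_mkseq npairK.
Qed.

Hypothesis scP : @second_countable P.
Hypothesis mphi : forall A : set X, measurable A <->
  exists2 B : set P, <<s open >> B & A = phi @^-1` B.

(** Radii run through a countable set in order that sets defined by balls are
    countable combinations of measurable ones. *)
Definition rad (n : nat) : R := n.+1%:R^-1.

Lemma rad_gt0 n : 0 < rad n. Proof. by rewrite invr_gt0. Qed.

Lemma rad_le m n : (m <= n)%N -> rad n <= rad m.
Proof. by move=> mn; rewrite lef_pV2 ?posrE// ler_nat. Qed.

Lemma rad_small (e : R) : 0 < e -> exists n, rad n + rad n < e.
Proof.
move=> e0; have e2 : 0 < e / 2 by rewrite divr_gt0.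
have [n _ /(_ n (leqnn _))] := near_infty_natSinv_lt (PosNum e2).
by move=> /= h; exists n; rewrite [ltRHS]splitr ltrD.
Qed.

Lemma closure_ball (p q : P) (e e' : R) : 0 < e' ->
  closure (ball p e) q -> ball p (e + e') q.
Proof.
move=> e'0 /(_ _ (nbhsx_ballx q e' e'0))[r [pr qr]].
by apply: ball_triangle pr _; exact: ball_sym.
Qed.

Lemma open_Fsigma (O : set P) : open O ->
  exists C : nat -> set P, (forall n, closed (C n)) /\ O = \bigcup_n C n.
Proof.
move=> oO; have [c hc] := second_countable_dense (phi point) scP.
pose good ij := closure (ball (c ij.1) (rad ij.2)) `<=` O.
pose C n := if @unpickle (nat * nat)%type n is Some ij then
  (if `[< good ij >] then closure (ball (c ij.1) (rad ij.2)) else set0) else set0.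
exists C; split.
  move=> n; rewrite /C; case: unpickle => [ij|]; last exact: closed0.
  by case: asboolP => _; [exact: closed_closure|exact: closed0].
apply/seteqP; split => p; last first.
  move=> [n _]; rewrite /C; case: unpickle => [ij|//].
  by case: asboolP => // gij; exact: gij.
move=> Op; have /nbhs_ballP[e /= e0 he] : nbhs p O by exact: open_nbhs_nbhs.
have [n hn] := @rad_small (e / 2) ltac:(by rewrite divr_gt0).
have [i hi] := hc p (rad n) (rad_gt0 n).
have gin : good (i, n).
  move=> q /= /(closure_ball (rad_gt0 n)) hq; apply: he.
  apply: (@le_ball _ _ _ (rad n + (rad n + rad n))).
    by move: hn (rad_gt0 n); lra.
  by apply: ball_triangle hq; exact: ball_sym.
exists (pickle (i, n)) => //; rewrite /C pickleK; case: asboolP => // _.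
exact: subset_closure.
Qed.

(** Souslin sets are not closed under complements; asking for the complement
    to be Souslin as well gives a sigma-algebra. *)
Lemma bisouslin_sigma_algebra :
  sigma_algebra setT [set E | souslin E /\ souslin (~` E)].
Proof.
have s0 : souslin set0.
  rewrite (_ : set0 = [set z | (set0 : set X) z.1 /\ (set0 : set P) (phi z.2)]).
    by apply: souslin_rect; [exact: measurable0|exact: closed0].
  by apply/seteqP; split => z // [].
split => /=.
- rewrite setC0; split => //.
  rewrite (_ : setT = [set z | (setT : set X) z.1 /\ (setT : set P) (phi z.2)]).
    by apply: souslin_rect; [exact: measurableT|exact: closedT].
  by apply/seteqP; split => z.
- by move=> A [sA sA']; rewrite setTD setCK.
- move=> F hF; split; first by apply: souslin_bigcup => n; have [] := hF n.
  by rewrite setC_bigcup; apply: souslin_bigcap => n; have [] := hF n.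
Qed.

Lemma measurable_souslin (E : set (X * X)) : measurable E -> souslin E.
Proof.
have [G0 GC GU] := bisouslin_sigma_algebra.
suff H : (d, d).-prod.-measurable `<=` [set E | souslin E /\ souslin (~` E)].
  by move=> /H[].
apply: smallest_sub; first exact: bisouslin_sigma_algebra.
rewrite subUset; split => _ [A mA <-]; rewrite setTI /=.
  rewrite (_ : fst @^-1` A = [set z | A z.1 /\ (setT : set P) (phi z.2)]); last first.
    by apply/seteqP; split => z // [].
  rewrite (_ : ~` _ = [set z | (~` A) z.1 /\ (setT : set P) (phi z.2)]); last first.
    apply/seteqP; split => z /= h; last by case: h => h _ [? _]; exact: h.
    by split => // ?; exact: h.
  by split; apply: souslin_rect; rewrite ?closedT//; exact: measurableC.
move: mA => /mphi[B sB ->].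
suff : <<s open >> `<=` [set B | [set E | souslin E /\ souslin (~` E)]
    ((snd : X * X -> X) @^-1` (phi @^-1` B))] by move=> /(_ _ sB).
apply: smallest_sub.
  split => /=.
  - by move: G0; rewrite /= !preimage_set0.
  - by move=> V hV; have := GC _ hV; rewrite /= !setTD.
  - move=> F hF; have := GU _ hF; by rewrite /= !preimage_bigcup.
move=> O oO /=; split.
  have [C [cC ->]] := open_Fsigma oO.
  rewrite !preimage_bigcup; apply: souslin_bigcup => n.
  rewrite (_ : _ @^-1` _ = [set z | (setT : set X) z.1 /\ C n (phi z.2)]); last first.
    by apply/seteqP; split => z // [].
  by apply: souslin_rect.
rewrite (_ : ~` _ = [set z | (setT : set X) z.1 /\ (~` O) (phi z.2)]); last first.
  by apply/seteqP; split => z // [].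
by apply: souslin_rect => //; exact: open_closedC.
Qed.

End souslin.

(** * Sets covered by countably many measurable graphs *)

Section thin_sets.
Variables (R : realType) (d : measure_display) (X : measurableType d).
Variable mu : probability X R.

Lemma ae_forall_count (I : countType) (Q : I -> X -> Prop) :
  (forall i, {ae mu, forall x, Q i x}) -> {ae mu, forall x, forall i, Q i x}.
Proof.
move=> hQ; pose Q' n x := if @unpickle I n is Some i then Q i x else True.
have : {ae mu, forall x, forall n, Q' n x}.
  apply: ae_foralln => n; rewrite /Q'; case: (unpickle n) => [i|]; first exact: hQ.
  exact: aeW.
by apply: filterS => x h i; have := h (pickle i); rewrite /Q' pickleK.
Qed.

(** Thin sets are the sigma-ideal generated by the graphs of measurable maps
    and the sets that live over a null set. *)
Definition thin (A : set (X * X)) := exists f : nat -> X -> X,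
  (forall n, measurable_fun setT (f n)) /\
  {ae mu, forall x, forall y, A (x, y) -> exists n, y = f n x}.

Lemma thin_ae_sub (A B : set (X * X)) :
  {ae mu, forall x, forall y, A (x, y) -> B (x, y)} -> thin B -> thin A.
Proof.
move=> AB [f [mf hf]]; exists f; split => //.
by apply: filterS2 AB hf => x AB hf y /AB/hf.
Qed.

Lemma thinS (A B : set (X * X)) : A `<=` B -> thin B -> thin A.
Proof. by move=> AB; apply: thin_ae_sub; apply: aeW => x y; exact: AB. Qed.

Lemma thin_graph (f : X -> X) : measurable_fun setT f ->
  thin [set z | z.2 = f z.1].
Proof.
by move=> mf; exists (fun=> f); split => //; apply: aeW => x y /= ->; exists 0%N.
Qed.

Lemma thin0 : thin set0.
Proof. by apply: thinS (thin_graph (@measurable_id _ X setT)). Qed.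

Lemma thin_bigcup (I : countType) (A : I -> set (X * X)) :
  (forall i, thin (A i)) -> thin (\bigcup_i A i).
Proof.
move=> /choice[f hf].
exists (fun k => if @unpickle (I * nat)%type k is Some ij then f ij.1 ij.2 else id).
split => [k|].
  by case: (unpickle k) => [[i j]|]; [exact: (hf i).1|exact: measurable_id].
have : {ae mu, forall x, forall i, forall y, A i (x, y) -> exists n, y = f i n x}.
  by apply: ae_forall_count => i; exact: (hf i).2.
apply: filterS => x h y [i _ /h[n ->]].
by exists (pickle (i, n)); rewrite pickleK.
Qed.

(** By countable additivity there is a largest measurable set of base points,
    modulo null sets, over which A is thin; B is its complement. *)
Lemma essential_support (A : set (X * X)) : exists B : set X,
  [/\ measurable B, thin (A `&` [set z | ~ B z.1]) &
      forall D, measurable D -> thin (A `&` [set z | D z.1]) ->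
        {ae mu, forall x, D x -> ~ B x}].
Proof.
pose V := [set D | measurable D /\ thin (A `&` [set z | D z.1])].
pose s := ereal_sup (mu @` V).
have V0 : V set0.
  split; first exact: measurable0.
  by apply: thinS thin0 => z [].
have sfin : s \is a fin_num.
  rewrite ge0_fin_numE; last by apply: ereal_sup_ubound; exists set0; rewrite ?measure0.
  apply: (@le_lt_trans _ _ 1%E); last exact: ltry.
  by apply: ge_ereal_sup => _ [D [mD _] <-]; exact: probability_le1.
have /choice[C hC] n : exists C, V C /\ (s - (n.+1%:R^-1)%:E < mu C)%E.
  have e0 : (0 < n.+1%:R^-1 :> R) by rewrite invr_gt0.
  by have [_ [D VD <-] sD] := ub_ereal_sup_adherent e0 sfin; exists D.
have mC : measurable (\bigcup_n C n).
  by apply: bigcup_measurable => n _; have [[]] := hC n.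
have VC : V (\bigcup_n C n).
  split => //; apply: (@thinS _ (\bigcup_n (A `&` [set z | C n z.1]))).
    by move=> z [Az [n _ Cz]]; exists n.
  by apply: thin_bigcup => n; have [[]] := hC n.
exists (~` \bigcup_n C n); split.
- exact: measurableC.
- by apply: thinS VC.2 => z [Az /contrapT Cz]; split.
move=> D mD tD.
have VCD : V (D `|` \bigcup_n C n).
  split; first exact: measurableU.
  apply: (@thinS _ (\bigcup_(b : bool) (A `&` [set z | (if b then D else \bigcup_n C n) z.1]))).
    by move=> z [Az [Dz|Cz]]; [exists true|exists false].
  by apply: thin_bigcup => -[] //; exact: VC.2.
have muC : mu (\bigcup_n C n) = s.
  apply/eqP; rewrite eq_le; apply/andP; split.
    by apply: ereal_sup_ubound; exists (\bigcup_n C n).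
  rewrite -(fineK sfin); apply/lee_subgt0Pr => e e0.
  have [n _ /(_ n (leqnn _)) /= hn] := near_infty_natSinv_lt (PosNum e0).
  rewrite fineK//; apply: (@le_trans _ _ (s - (n.+1%:R^-1)%:E)%E).
    by rewrite EFinN; apply: leeB => //; rewrite lee_fin ltW.
  apply: (le_trans (ltW (hC n).2)).
  by apply: le_measure; rewrite ?inE//; [have [[]] := hC n|exact: bigcup_sup].
exists (D `\` \bigcup_n C n); split.
- exact: measurableD.
- have : (mu (D `|` \bigcup_n C n) <= s)%E.
    by apply: ereal_sup_ubound; exists (D `|` \bigcup_n C n).
  have -> : mu (D `|` \bigcup_n C n) = (mu (\bigcup_n C n) + mu (D `\` \bigcup_n C n))%E.
    rewrite -measureU//; [|exact: measurableD|by rewrite setDE setICA setICr setI0].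
    by rewrite setUDr setDv setD0 setUC.
  rewrite muC -[leRHS]adde0 leeD2lE// => h.
  by apply/eqP; rewrite -measure_le0.
- by move=> x /= /not_implyP[Dx /contrapT h]; split.
Qed.

End thin_sets.

(** * Limits of countably-valued maps *)

Section measurable_limit.
Variables (R : realType) (d : measure_display) (X : measurableType d).
Variables (P : completePseudoMetricType R) (phi : X -> P).
Hypothesis hP : hausdorff_space P.
Hypothesis scP : @second_countable P.
Hypothesis bphi : bijective phi.
Hypothesis mphi : forall A : set X, measurable A <->
  exists2 B : set P, <<s open >> B & A = phi @^-1` B.

Local Notation rad := (@rad R).

Lemma ball_eq (p q : P) : (forall k, ball p (rad k) q) -> p = q.
Proof.
move=> h; apply: hP => A B /nbhs_ballP[e /= e0 hA] hB.
exists q; split; last exact: nbhs_singleton.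
apply: hA; have [k hk] := rad_small e0.
by apply: le_ball (h k); move: hk (rad_gt0 R k); lra.
Qed.

Lemma measurable_phi_open O : open O -> measurable (phi @^-1` O).
Proof. by move=> oO; apply/mphi; exists O => //; exact: sub_sigma_algebra. Qed.

Lemma measurable_fun_phi (f : X -> X) :
  (forall O, open O -> measurable [set x | O (phi (f x))]) ->
  measurable_fun setT f.
Proof.
move=> hf _ A /mphi[B sB ->]; rewrite setTI.
suff : <<s open >> `<=` [set B | measurable (f @^-1` (phi @^-1` B))].
  by move=> /(_ _ sB).
apply: smallest_sub; last exact: hf.
split => /=.
- by rewrite !preimage_set0.
- by move=> V hV; rewrite setTD; exact: measurableC hV.
- by move=> F hF; rewrite !preimage_bigcup; exact: bigcup_measurable.
Qed.

(** Convergence with countable quantifiers only, so that the set of points at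
    which a sequence of maps converges is visibly measurable. *)
Definition conv (u : nat -> P) (p : P) :=
  forall k, exists N, forall n, (N <= n)%N -> ball p (rad k) (u n).

Lemma conv_uniq u p q : conv u p -> conv u q -> p = q.
Proof.
move=> up uq; apply: ball_eq => k.
have [m hm] := rad_small (rad_gt0 R k).
have [N1 h1] := up m; have [N2 h2] := uq m.
apply: (le_ball (ltW hm)).
apply: (ball_triangle (h1 (maxn N1 N2) (leq_maxl _ _))).
by apply: ball_sym; apply: h2; exact: leq_maxr.
Qed.

Lemma conv_complete (u : nat -> P) :
  (forall k, exists q N, forall n, (N <= n)%N -> ball q (rad k) (u n)) ->
  exists p, conv u p.
Proof.
move=> hu.
have cu : cvg (u @ \oo).
  apply: cauchy_cvg; apply: cauchy_exP => e e0.
  have [k hk] := rad_small e0.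
  have [q [N hN]] := hu k; exists q; exists N => // n /= /hN.
  by apply: le_ball; move: hk (rad_gt0 R k); lra.
exists (lim (u @ \oo)) => k.
have /cvg_ballP/(_ _ (rad_gt0 R k))[N _ hN] := cu.
by exists N => n Nn; exact: hN.
Qed.

(** Measurability for every set of values, open or not, is what a map with
    countably many values satisfies.  The limit exists on a measurable set by
    completeness, and outside that set any constant can be taken. *)
Lemma measurable_limit (a : nat -> X -> P) :
  (forall n V, measurable [set x | V (a n x)]) ->
  exists f : X -> X, measurable_fun setT f /\
    forall x y, conv (a ^~ x) (phi y) -> y = f x.
Proof.
move=> ma; have [c hc] := second_countable_dense (phi point) scP.
have pinj := bij_inj bphi.
have [psi phiK psiK] := bphi.
pose Cv := [set x | exists p, conv (a ^~ x) p].
have mCv : measurable Cv.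
  rewrite (_ : Cv = \bigcap_k \bigcup_i \bigcup_N \bigcap_(n in [set n | (N <= n)%N])
      [set x | ball (c i) (rad k) (a n x)]).
    apply: bigcap_measurable; first by exists 0%N.
    move=> k _.
    apply: bigcup_measurable => i _; apply: bigcup_measurable => N _.
    by apply: bigcap_measurable; [exists N => /=|move=> n _; exact: ma].
  apply/seteqP; split => x.
    move=> [p hp] k _; have [m hm] := rad_small (rad_gt0 R k).
    have [i hi] := hc p _ (rad_gt0 R m); have [N hN] := hp m.
    exists i => //; exists N => // n /= Nn; apply: (le_ball (ltW hm)).
    by apply: (ball_triangle hi); exact: hN.
  move=> hx; apply: conv_complete => k.
  by have [i _ [N _ hN]] := hx k I; exists (c i), N.
have /choice[f hf] x : exists y, (Cv x -> conv (a ^~ x) (phi y)) /\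
    (~ Cv x -> y = point).
  have [Cx|Cx] := pselect (Cv x); last by exists point; split.
  by have [p hp] := Cx; exists (psi p); rewrite psiK; split.
exists f; split; last first.
  move=> x y hy; apply: pinj; apply: (conv_uniq hy).
  by apply: (hf x).1; exists (phi y).
apply: measurable_fun_phi => O oO.
(* The limit lies in O if and only if some ball whose double stays inside O
   eventually contains the sequence. *)
pose near_in (i k : nat) := if `[< ball (c i) (rad k + rad k) `<=` O >] then
  \bigcup_N \bigcap_(n in [set n | (N <= n)%N])
      [set x | ball (c i) (rad k) (a n x)] else set0.
rewrite (_ : [set x | _] = (Cv `&` \bigcup_i \bigcup_k near_in i k) `|`
    (~` Cv `&` [set _ | O (phi point)])).
  apply: measurableU; apply: measurableI => //.
  - apply: bigcup_measurable => i _; apply: bigcup_measurable => k _.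
    rewrite /near_in; case: asboolP => // _; apply: bigcup_measurable => N _.
    by apply: bigcap_measurable; [exists N => /=|move=> n _; exact: ma].
  - exact: measurableC.
  - have [Op|Op] := pselect (O (phi point)).
      by rewrite (_ : [set _ | _] = setT)//; apply/seteqP; split.
    by rewrite (_ : [set _ | _] = set0)//; apply/seteqP; split.
apply/seteqP; split => x /=.
  have [Cx|Cx] := pselect (Cv x); last first.
    by move=> h; right; split => //; rewrite -((hf x).2 Cx).
  move=> Ofx; left; split => //.
  have /nbhs_ballP[e /= e0 he] : nbhs (phi (f x)) O by exact: open_nbhs_nbhs.
  have [k hk] := @rad_small R (e / 2) ltac:(by rewrite divr_gt0).
  have [m hm] := rad_small (rad_gt0 R k).
  have [i hi] := hc (phi (f x)) _ (rad_gt0 R m).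
  exists i => //; exists k => //; rewrite /near_in; case: asboolP; last first.
    case=> q hq; apply: he; apply: (@le_ball _ _ _ (rad m + (rad k + rad k))).
      by move: hk hm (rad_gt0 R m) (rad_gt0 R k); lra.
    by apply: ball_triangle hq; exact: ball_sym.
  move=> _; have [N hN] := (hf x).1 Cx m.
  exists N => // n /= Nn; apply: (le_ball (ltW hm)).
  by apply: (ball_triangle hi); exact: hN.
move=> [[Cx [i _ [k _]]]|[Cx Op]]; last by rewrite ((hf x).2 Cx).
rewrite /near_in; case: asboolP => // hO [N _ hN].
have [N' hN'] := (hf x).1 Cx k.
apply: hO; apply: (@ball_triangle _ _ (a (maxn N N') x)).
  by apply: hN => /=; exact: leq_maxl.
by apply: ball_sym; apply: hN'; exact: leq_maxr.
Qed.

(** Selecting the first index makes the choice measurable. *)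
Lemma measurable_first (G : nat -> set X) : (forall k, measurable (G k)) ->
  exists sel : X -> nat, (forall V : set nat, measurable [set x | V (sel x)]) /\
    forall x k, G k x -> G (sel x) x.
Proof.
move=> mG.
have /choice[sel hsel] x : exists k,
    ((exists k, G k x) -> G k x /\ forall j, (j < k)%N -> ~ G j x) /\
    (~ (exists k, G k x) -> k = 0%N).
  have [[k Gk]|H] := pselect (exists k, G k x); last by exists 0%N; split.
  have ex : exists k, `[< G k x >] by exists k; apply/asboolP.
  exists (ex_minn ex); case: ex_minnP => m /asboolP Gm hm.
  split => [_|[]]; last by exists k.
  by split => // j jm /asboolP/hm; rewrite leqNgt jm.
exists sel; split; last by move=> x k Gk; apply: (proj1 ((hsel x).1 _)); exists k.
have mcst (Q : Prop) : measurable [set _ : X | Q].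
  have [q|nq] := pselect Q.
    by rewrite (_ : [set _ | _] = setT)//; apply/seteqP; split.
  by rewrite (_ : [set _ | _] = set0)//; apply/seteqP; split.
move=> V; rewrite (_ : [set x | _] =
  (\bigcup_k ((G k `\` \bigcup_(j < k) G j) `&` [set _ | V k])) `|`
  (~` (\bigcup_k G k) `&` [set _ | V 0%N])).
  apply: measurableU; last first.
    by apply: measurableI => //; apply: measurableC; exact: bigcup_measurable.
  apply: bigcup_measurable => k _; apply: measurableI => //.
  by apply: measurableD => //; exact: bigcup_measurable.
apply/seteqP; split => x /=.
  move=> Vx; have [ex|nex] := pselect (exists k, G k x).
    have [Gs hs] := (hsel x).1 ex; left; exists (sel x) => //; split => //.
    by split => // -[j /= js Gj]; exact: (hs j).
  by right; split; [move=> [k _ Gk]; apply: nex; exists k|rewrite -((hsel x).2 nex)].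
move=> [[k _ [[Gk hk] Vk]]|[nG V0]].
  have [Gs hs] := (hsel x).1 (ex_intro _ k Gk).
  have [sk|ks|->//] := ltngtP (sel x) k.
    by exfalso; apply: hk; exists (sel x).
  by exfalso; exact: hs ks Gk.
by rewrite (hsel x).2// => -[k Gk]; apply: nG; exists k.
Qed.

End measurable_limit.

(** * Measurable sets with countable sections *)

Section lusin_novikov.
Variables (R : realType) (d : measure_display) (X : measurableType d).
Variables (mu : probability X R).
Variables (P : completePseudoMetricType R) (phi : X -> P).
Hypothesis hP : hausdorff_space P.
Hypothesis scP : @second_countable P.
Hypothesis bphi : bijective phi.
Hypothesis mphi : forall A : set X, measurable A <->
  exists2 B : set P, <<s open >> B & A = phi @^-1` B.

Local Notation rad := (@rad R).
Local Notation T := (nat * nat)%type.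

(** Intersecting with a cover of P by small balls at each level makes the
    closed sets shrink along every branch.  The second component of a letter
    is the index of the ball. *)
Lemma souslin_small (E : set (X * X)) : souslin phi E ->
  exists (D : seq T -> set X) (K : seq T -> set P),
  [/\ forall s, measurable (D s), forall s, closed (K s),
      forall z, E z <-> exists u : nat -> T, forall n,
        D (mkseq u n) z.1 /\ K (mkseq u n) (phi z.2) &
      forall e : R, 0 < e -> exists N, forall s, (N < size s)%N ->
        forall p q, K s p -> K s q -> ball p e q].
Proof.
move=> [D [K [mD cK hE]]].
have [c hc] := second_countable_dense (phi point) scP.
exists (fun s => D (map fst s)).
exists (fun s => K (map fst s) `&` (if s is a :: t then
  closure (ball (c (last a t).2) (rad (size t))) else setT)); split => //.
- move=> [|a t]; first by rewrite setIT.
  by apply: closedI => //; exact: closed_closure.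
- have mapfst (u : nat -> T) n : map fst (mkseq u n) = mkseq (fst \o u) n.
    by rewrite /mkseq -map_comp.
  move=> z; rewrite hE; split => [[u hu]|[u hu]]; last first.
    by exists (fst \o u) => n; have := hu n; rewrite mapfst => -[? []].
  have /choice[w hw] n : exists i, ball (c i) (rad n) (phi z.2).
    by apply: hc; exact: rad_gt0.
  exists (fun n => (u n, w n)) => n; rewrite mapfst.
  have [h1 h2] := hu n; split => //; split => //.
  case: n {h1 h2} => //= n; rewrite size_map size_iota.
  rewrite (last_map (fun n => (u n, w n))) /=.
  have -> : last 0%N (iota 1 n) = n.
    by case: n => // n; rewrite -(addn1 n) iotaD last_cat /= add1n addn1.
  by apply: subset_closure; exact: hw.
move=> e e0; have [k hk] := @rad_small R (e / 2) ltac:(by rewrite divr_gt0).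
exists k => -[//|a t] /= kt p q [_ hp] [_ hq].
have := closure_ball (rad_gt0 R k) hp; have := closure_ball (rad_gt0 R k) hq.
move=> h1 /ball_sym h2; apply: le_ball (ball_triangle h2 h1).
have := @rad_le R _ _ (ltnSE kt); move: hk; lra.
Qed.

Definition ext (s t : seq T) : Prop := take (size s) t = s.

Lemma take_mkseq (u : nat -> T) m n : (m <= n)%N ->
  take m (mkseq u n) = mkseq u m.
Proof. by move=> mn; rewrite /mkseq -map_take take_iota (minn_idPl mn). Qed.

Section scheme.
Variables (D : seq T -> set X) (K : seq T -> set P).
Hypothesis mD : forall s, measurable (D s).
Hypothesis cK : forall s, closed (K s).
Hypothesis smallK : forall e : R, 0 < e -> exists N, forall s, (N < size s)%N ->
        forall p q, K s p -> K s q -> ball p e q.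

Definition branch s : set (X * X) := [set z | exists u : nat -> T,
  mkseq u (size s) = s /\
  forall n, D (mkseq u n) z.1 /\ K (mkseq u n) (phi z.2)].

Variable B : seq T -> set X.
Hypothesis mB : forall s, measurable (B s).
Hypothesis thinB : forall s, thin mu (branch s `&` [set z | ~ B s z.1]).
Hypothesis maxB : forall s C, measurable C ->
  thin mu (branch s `&` [set z | C z.1]) -> {ae mu, forall x, C x -> ~ B s x}.

(** Over the complement of [D (take m s)] the branch is empty, hence thin. *)
Lemma support_sub : {ae mu, forall x, forall s, B s x ->
  forall m, (m <= size s)%N -> D (take m s) x}.
Proof.
have : {ae mu, forall x, forall sm : seq T * nat, (sm.2 <= size sm.1)%N ->
    ~ D (take sm.2 sm.1) x -> ~ B sm.1 x}.
  apply: ae_forall_count => -[s m] /=.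
  have [ms|ms] := leqP m (size s); last by apply: aeW => x.
  have := @maxB s (~` D (take m s)) (measurableC (mD _)) _.
  have h : thin mu (branch s `&` [set z | (~` D (take m s)) z.1]).
    apply: thinS (thin0 mu) => z [[u [us hu]]] /=; apply.
    by have [+ _] := hu m; rewrite -us take_mkseq.
  by move=> /(_ h); apply: filterS => x h' _; exact: h'.
apply: filterS => x h s Bs m ms; apply: contrapT => nD.
exact: (h (s, m)).
Qed.

Lemma support_nonempty : {ae mu, forall x, forall s, B s x ->
  exists y, forall m, (m <= size s)%N -> K (take m s) (phi y)}.
Proof.
apply: ae_forall_count => s.
have [H|H] := pselect (exists y, forall m, (m <= size s)%N -> K (take m s) (phi y)).
  by apply: aeW.
have := @maxB s setT measurableT _.
have h : thin mu (branch s `&` [set z | setT z.1]).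
  apply: thinS (thin0 mu) => z [[u [us hu]] _]; apply: H; exists z.2 => m ms.
  by have [_] := hu m; rewrite -[in take _ _]us take_mkseq.
by move=> /(_ h); apply: filterS => x /(_ I).
Qed.

(** The two extensions need not have the same length; what matters is that no
    point of P is compatible with both. *)
Definition splits s : set X := \bigcup_(t : seq T * seq T)
  if `[< [/\ ext s t.1, ext s t.2, (size s < size t.1)%N, (size s < size t.2)%N &
          forall p, ~ (K t.1 p /\ K t.2 p)] >]
  then B t.1 `&` B t.2 else set0.

Lemma measurable_splits s : measurable (splits s).
Proof.
apply: countable_bigcupT_measurable; first exact: countableP.
move=> t.
by case: asboolP => // _; exact: measurableI.
Qed.

(** Let y be followed by a sequence u whose restrictions keep x in their
    supports.  If x is unsplit, then the closed set of any long extension of s with x in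
    its support meets the closed sets of u, so that its points are close to y.
    Picking, for each length, the first such extension gives approximations of
    y that depend on x in a measurable way. *)
Lemma unsplit_graph s : exists f : X -> X, measurable_fun setT f /\
  forall x y, ~ splits s x ->
  (exists u, [/\ mkseq u (size s) = s, forall n, B (mkseq u n) x &
     forall n, K (mkseq u n) (phi y)]) -> y = f x.
Proof.
pose G n k := if @unpickle (seq T) k is Some t then
  (if `[< [/\ ext s t, size t = n & exists p, K t p] >] then B t else set0) else set0.
have mG n k : measurable (G n k).
  by rewrite /G; case: unpickle => // t; case: asboolP.
have /choice[sel hsel] n := measurable_first (mG n).
have /choice[pt hpt] (t : seq T) : exists p, (exists p, K t p) -> K t p.
  have [[p Kp]|H] := pselect (exists p, K t p); first by exists p.
  by exists (phi point).
pose a n x := if @unpickle (seq T) (sel n x) is Some t then pt t else phi point.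
have [|f [mf hf]] := @measurable_limit R d X P phi hP scP bphi mphi a.
  move=> n V; exact: ((hsel n).1 [set k |
    V (if @unpickle (seq T) k is Some t then pt t else phi point)]).
exists f; split => // x y nsx [u [us uB uK]].
(* Half of the radius rad k, because the estimate goes through two closed
   sets. *)
apply: hf => k; have [N hN] := smallK (rad_gt0 R k.*2.+1).
exists (maxn N (size s)).+1 => n; rewrite gtn_max => /andP[Nn sn].
have mext : ext s (mkseq u n) by rewrite /ext take_mkseq// ltnW.
have Gx : G n (pickle (mkseq u n)) x.
  rewrite /G pickleK; case: asboolP => // -[]; split => //.
    by rewrite size_mkseq.
  by exists (phi y).
have := (hsel n).2 _ _ Gx; rewrite /a /G.
case: unpickle => // t; case: asboolP => // -[st tn Kt] Bt.
have [q [Kq1 Kq2]] : exists q, K (mkseq u n) q /\ K t q.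
  apply: contrapT => H; apply: nsx.
  exists (mkseq u n, t) => //; case: asboolP => // -[] /=; split => //.
  - by rewrite size_mkseq.
  - by rewrite tn.
  - by move=> p Kp; apply: H; exists p.
have h1 := hN (mkseq u n) _ _ _ (uK n) Kq1.
have h2 := hN t _ _ _ Kq2 (hpt t Kt).
have := ball_triangle (h1 _) (h2 _); rewrite size_mkseq tn => /(_ Nn Nn).
apply: le_ball; rewrite /rad -doubleS -mul2n natrM invfM.
by rewrite [2^-1 * _]mulrC -splitr.
Qed.

(** Over the unsplit points, a point of the branch either leaves the support
    of some longer sequence, and then belongs to one of countably many thin
    sets, or stays in all of them, and then lies on the graph of
    [unsplit_graph]. *)
Lemma support_splits : {ae mu, forall x, forall s, B s x -> splits s x}.
Proof.
apply: ae_forall_count => s.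
have := @maxB s (~` splits s) (measurableC (measurable_splits s)) _.
have h : thin mu (branch s `&` [set z | (~` splits s) z.1]).
  have [f [mf hf]] := unsplit_graph s.
  apply: (@thinS _ _ _ _ _ ([set z | z.2 = f z.1] `|`
      \bigcup_t (branch t `&` [set z | ~ B t z.1]))); last first.
    apply: (@thinS _ _ _ _ _ (\bigcup_(b : bool) if b then [set z | z.2 = f z.1] else
       \bigcup_t (branch t `&` [set z | ~ B t z.1]))).
      by move=> z [h|h]; [exists true|exists false].
    apply: thin_bigcup => -[]; [exact: thin_graph|exact: thin_bigcup].
  move=> [x y] [[u [us hu]] /= nsx].
  have [uB|/existsNP[n nB]] := pselect (forall n, B (mkseq u n) x).
    left; apply: hf => //; exists u; split => // n; exact: (hu n).2.
  right; exists (mkseq u n) => //; split => //; exists u; split => //.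
  by rewrite size_mkseq.
move=> /(_ h); apply: filterS => x h' Bs; apply: contrapT => /h'; exact.
Qed.

(** A diagonal argument at a single x: of two disjoint extensions, at least
    one avoids the n-th point of a putative enumeration of the section. *)
Lemma splitting_uncountable x :
  (forall s, B s x -> forall m, (m <= size s)%N -> D (take m s) x) ->
  (forall s, B s x ->
     exists y, forall m, (m <= size s)%N -> K (take m s) (phi y)) ->
  (forall s, B s x -> splits s x) -> B [::] x ->
  ~ countable [set y | branch [::] (x, y)].
Proof.
move=> hD hK hS Bx /countable_injP[f finj].
(* yy is an enumeration of the section, with arbitrary values at the indices
   that enumerate nothing. *)
have /choice[yy hyy] n : exists y, forall y', branch [::] (x, y') -> f y' = n -> y' = y.
  have [[y [hy fy]]|H] := pselect (exists y, branch [::] (x, y) /\ f y = n).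
    exists y => y' hy' fy'; apply: finj; rewrite ?fy//; exact: mem_set.
  by exists point => y' hy' fy'; exfalso; apply: H; exists y'.
have step n s : exists t, B s x ->
    [/\ B t x, ext s t, (size s < size t)%N & ~ K t (phi (yy n))].
  have [Bs|nBs] := pselect (B s x); last by exists s.
  have [[t0 t1] _ /=] := hS s Bs; case: asboolP => // -[e0 e1 s0 s1 disj] [B0 B1].
  have [K0|K0] := pselect (K t0 (phi (yy n))); last by exists t0.
  have [K1|K1] := pselect (K t1 (phi (yy n))); last by exists t1.
  by exfalso; exact: disj (conj K0 K1).
have /choice[F hF] : forall ns : nat * seq T, exists t, B ns.2 x ->
    [/\ B t x, ext ns.2 t, (size ns.2 < size t)%N & ~ K t (phi (yy ns.1))].
  by move=> [n s]; exact: step.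
pose sg := fix sg n := if n is m.+1 then F (m, sg m) else [::].
have Bsg n : B (sg n) x.
  by elim: n => // n IH; have [] := hF (n, sg n) IH.
have ext_sg n : ext (sg n) (sg n.+1) by have [] := hF (n, sg n) (Bsg n).
have size_sg n : (size (sg n) < size (sg n.+1))%N by have [] := hF (n, sg n) (Bsg n).
have avoid n : ~ K (sg n.+1) (phi (yy n)) by have [] := hF (n, sg n) (Bsg n).
have size_ge n : (n <= size (sg n))%N.
  by elim: n => // n IH; exact: leq_ltn_trans IH (size_sg n).
have ext_le m n : (m <= n)%N -> take (size (sg m)) (sg n) = sg m.
  move=> /subnK <-; elim: (n - m)%N => [|k IH]; first by rewrite add0n take_size.
  rewrite addSn -[RHS]IH -[in RHS](ext_sg (k + m)%N) take_takel//.
  have := congr1 size IH; rewrite size_take; case: ltnP => [/ltnW//|].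
  by move=> h <-.
pose u i := nth (0%N, 0%N) (sg i.+1) i.
have uE n k : (n <= k)%N -> take n (sg k) = mkseq u n.
  move=> nk; apply: (@eq_from_nth _ (0%N, 0%N)).
    by rewrite size_mkseq size_takel// (leq_trans nk).
  move=> i; rewrite size_takel ?(leq_trans nk)// => ni.
  rewrite nth_take// nth_mkseq// /u.
  have ik : (i.+1 <= k)%N by exact: leq_trans ni nk.
  by rewrite -(ext_le _ _ ik) nth_take.
have sgE n : sg n = mkseq u (size (sg n)).
  rewrite -(uE _ (maxn n (size (sg n)))) ?leq_maxr//.
  by rewrite ext_le// leq_maxl.
have /choice[y hy] n : exists y, forall m, (m <= n)%N -> K (mkseq u m) (phi y).
  have [y hy] := hK _ (Bsg n); exists y => m mn; rewrite -(uE _ n)//.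
  by apply: hy; rewrite (leq_trans mn).
have [q hq] : exists q, conv (phi \o y) q.
  apply: conv_complete => k; have [N hN] := smallK (rad_gt0 R k).
  exists (phi (y N.+1)), N.+1 => n Nn /=.
  by apply: (hN (mkseq u N.+1)); rewrite ?size_mkseq//; exact: hy.
have Kq n : K (mkseq u n) q.
  apply: cK => A /nbhs_ballP[e /= e0 he].
  have [k hk] := rad_small e0; have [N hN] := hq k.
  exists (phi (y (maxn n N))); split; first by apply: hy; exact: leq_maxl.
  apply: he; apply: (@le_ball _ _ _ (rad k)).
    by move: hk (rad_gt0 R k); lra.
  by apply: hN; exact: leq_maxr.
have [psi _ psiK] := bphi.
have Eq : branch [::] (x, psi q).
  exists u; split => // n; rewrite psiK; split => //=.
  by rewrite -(uE n n)//; exact: hD.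
apply: (avoid (f (psi q))); rewrite -(hyy _ _ Eq erefl) psiK sgE.
exact: Kq.
Qed.

End scheme.

(** A Lusin-Novikov theorem modulo null sets: if the root of the scheme had a
    support of positive measure, some countable section would be
    uncountable. *)
Theorem thin_of_countable_sections (E : set (X * X)) : measurable E ->
  {ae mu, forall x, countable [set y | E (x, y)]} -> thin mu E.
Proof.
move=> mE cE.
have [D [K [mD cK hE smallK]]] := souslin_small (measurable_souslin scP mphi mE).
have /choice[B hB] s := essential_support mu (branch D K s).
have mB s : measurable (B s) by have [] := hB s.
have thinB s : thin mu (branch D K s `&` [set z | ~ B s z.1]) by have [] := hB s.
have maxB s : forall C, measurable C ->
  thin mu (branch D K s `&` [set z | C z.1]) -> {ae mu, forall x, C x -> ~ B s x}.
  by have [] := hB s.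
have EE : E = branch D K [::].
  apply/seteqP; split => z; first by move=> /hE[u hu]; exists u.
  by move=> [u [_ hu]]; apply/hE; exists u.
have nB : {ae mu, forall x, ~ B [::] x}.
  have H1 := support_sub mD maxB; have H2 := support_nonempty maxB.
  have H3 := support_splits smallK mB thinB maxB.
  apply: filterS2 cE (filterI H1 (filterI H2 H3)) => x cx [h1 [h2 h3]] Bx.
  by apply: (splitting_uncountable cK smallK h1 h2 h3 Bx); rewrite -EE.
apply: thin_ae_sub (thinB [::]).
by apply: filterS nB => x nBx y Exy; split => //=; rewrite -EE.
Qed.

End lusin_novikov.

(** * Standard Borel spaces *)

Section standard_borel_spaces.
Variables (R : realType) (d : measure_display) (X : measurableType d).
Hypothesis hX : standard_borel X R.

Lemma separating_sequence : exists B : nat -> set X,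
  (forall k, measurable (B k)) /\
  forall x y, x <> y -> exists k, B k x /\ ~ B k y.
Proof.
have [P [phi [hP scP bphi mphi]]] := hX.
have [c hc] := second_countable_dense (phi point) scP.
pose C (ij : nat * nat) := closure (ball (c ij.1) (rad R ij.2)).
exists (fun k =>
  if @unpickle (nat * nat)%type k is Some ij then phi @^-1` (C ij) else set0).
split.
  move=> k; case: unpickle => // ij.
  rewrite -[C ij]setCK preimage_setC; apply: measurableC.
  exact: (measurable_phi_open mphi (closed_openC (@closed_closure _ _))).
move=> x y xy; have /existsNP[k nk] : ~ forall k, ball (phi x) (rad R k) (phi y).
  by move=> h; apply: xy; apply: (bij_inj bphi); exact: (ball_eq hP h).
have [m hm] := @rad_small R (rad R k / 2) ltac:(by rewrite divr_gt0// rad_gt0).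
have [i hi] := hc (phi x) _ (rad_gt0 R m).
exists (pickle (i, m)); rewrite pickleK; split; first exact: subset_closure.
move=> /(closure_ball (rad_gt0 R m)) h; apply: nk.
apply: (@le_ball _ _ _ (rad R m + (rad R m + rad R m))).
  by move: hm (rad_gt0 R m); lra.
by apply: ball_triangle h; exact: ball_sym.
Qed.

Lemma measurable_diagonal : measurable [set z : X * X | z.1 = z.2].
Proof.
have [B [mB sepB]] := separating_sequence.
rewrite (_ : [set z | _] = \bigcap_k ~` (B k `*` ~` B k)).
  apply: bigcap_measurable; first by exists 0%N.
  move=> k _; apply: measurableC; apply: measurableX => //; exact: measurableC.
apply/seteqP; split => -[x y] /=; first by move=> -> k _ [].
move=> h; apply: contrapT => /sepB[k [Bx By]].
by apply: (h k I).
Qed.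

Lemma measurable_rel_fun d' (Y : measurableType d') (E : set (X * X))
    (f g : Y -> X) : measurable E ->
  measurable_fun setT f -> measurable_fun setT g -> measurable [set x | E (f x, g x)].
Proof.
move=> mE mf mg.
have := measurable_fun_pair mf mg measurableT mE.
by rewrite setTI.
Qed.

Lemma measurable_eq_fun d' (Y : measurableType d') (f g : Y -> X) :
  measurable_fun setT f -> measurable_fun setT g -> measurable [set x | f x = g x].
Proof. exact: (measurable_rel_fun measurable_diagonal). Qed.

Lemma countable_sections_thin (mu : probability X R) (E : set (X * X)) :
  measurable E -> {ae mu, forall x, countable [set y | E (x, y)]} -> thin mu E.
Proof.
move=> mE cE; have [P [phi [hP scP bphi mphi]]] := hX.
exact: (thin_of_countable_sections hP scP bphi mphi).
Qed.

End standard_borel_spaces.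

(** * Lower integrals and the measure of a relation *)

Section lower_integral.
Variables (R : realType) (d : measure_display) (X : measurableType d).
Variables (mu : probability X R).

(** The integral of a nonnegative function is a supremum over the simple
    functions below it, hence monotone without measurability.  This matters
    because x |-> #|E_x| need not be measurable for an arbitrary set E. *)
Lemma le_integral_nonmeasurable (f g : X -> \bar R) :
  (forall x, (0 <= f x)%E) -> (forall x, (f x <= g x)%E) ->
  (\int[mu]_x f x <= \int[mu]_x g x)%E.
Proof.
move=> f0 fg; have g0 x : (0 <= g x)%E by exact: le_trans (fg x).
rewrite !ge0_integralTE//; apply: le_ereal_sup => _ [h hf <-].
by exists h => // x; exact: le_trans (fg x).
Qed.

Lemma counting_ge0 (A : set X) : (0 <= counting A :> \bar R)%E.
Proof. by rewrite /counting; case: ifPn; rewrite ?lee_fin// lee_pinfty. Qed.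

Lemma counting_ge1 (A : set X) y : A y -> (1 <= counting A :> \bar R)%E.
Proof.
move=> Ay; rewrite /counting; case: asboolP => [fA|_]; last exact: leey.
rewrite lee_fin ler1n finmap.cardfs_gt0; apply/eqP => A0.
by move: Ay; rewrite (fset_set_set0 fA A0).
Qed.

Lemma rel_measure_ge0 (E : set (X * X)) : (0 <= rel_measure mu E)%E.
Proof. by apply: integral_ge0 => x _; exact: counting_ge0. Qed.

Lemma rel_measure_ge (T : set X) (E : set (X * X)) : measurable T ->
  (forall x, T x -> exists y, E (x, y)) -> (mu T <= rel_measure mu E)%E.
Proof.
move=> mT TE; rewrite -[T in leLHS]setIT -integral_indic//.
apply: le_integral_nonmeasurable => x; first by rewrite lee_fin.
rewrite indicE; case: (boolP (x \in T)) => [|_]; last exact: counting_ge0.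
by move=> /set_mem/TE[y Exy]; exact: (@counting_ge1 _ y).
Qed.

Lemma rel_measure_null_base (N : set X) (E : set (X * X)) : measurable N ->
  mu N = 0%E -> (forall x y, E (x, y) -> N x) -> rel_measure mu E = 0%E.
Proof.
move=> mN N0 EN; apply/eqP; rewrite eq_le rel_measure_ge0 andbT.
have <- : (\int[mu]_(x in N) (+oo : \bar R) = 0)%E.
  by rewrite integral_cst// [X in (_ * X)%E](_ : _ = 0%E) ?mule0.
rewrite [leRHS]integral_mkcond; apply: le_integral_nonmeasurable => x.
  exact: counting_ge0.
rewrite patchE; case: ifPn => [_|]; first exact: leey.
rewrite notin_setE => Nx; rewrite (_ : relclass E x = set0).
  by rewrite /counting; case: asboolP => [?|]; [rewrite fset_set0|case].
by apply/seteqP; split => // y /EN.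
Qed.

End lower_integral.

(** * The Feldman-Moore theorem *)

Section feldman_moore.
Variables (R : realType) (d : measure_display) (X : measurableType d).
Variables (mu : probability X R) (Rel : set (X * X)).
Hypothesis hX : standard_borel X R.
Hypothesis hR : pmp_relation mu Rel.

(** Null sets have null saturations: by invariance under the flip, the pairs
    whose second coordinate lies in a null set are as negligible as those
    whose first coordinate does. *)
Lemma ae_saturated (Q : X -> Prop) : {ae mu, forall x, Q x} ->
  {ae mu, forall x, forall y, Rel (x, y) -> Q y}.
Proof.
move=> [N [mN N0 QN]].
have [f [mf hf]] := countable_sections_thin hX (rel_measurable hR) (rel_discrete hR).
pose E := Rel `&` [set z | N z.2].
have mE : measurable E.
  apply: measurableI; first exact: rel_measurable hR.
  by rewrite (_ : [set z | _] = setT `*` N);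
    [exact: measurableX|apply/seteqP; split => z // []].
have E0 : rel_measure mu E = 0%E.
  rewrite -(rel_pmp hR mE); last by move=> z [].
  by apply: (rel_measure_null_base mN N0) => x y [].
have : {ae mu, forall x, forall n, ~ E (x, f n x)}.
  apply: ae_foralln => n; exists [set x | E (x, f n x)].
  have mT : measurable [set x | E (x, f n x)].
    exact: (measurable_rel_fun mE (@measurable_id _ _ _) (mf n)).
  split => //.
    apply/eqP; rewrite eq_le measure_ge0 andbT -E0.
    by apply: rel_measure_ge => // x Ex; exists (f n x).
  by move=> x /= /contrapT.
apply: filterS2 hf => x hx hE y xy; apply: contrapT => nQy.
have [n yE] := hx y xy; apply: (hE n); rewrite -yE; split => //=.
exact: QN.
Qed.

Lemma measurable_fun_if3 (D D' : set X) (f f' : X -> X) :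
  measurable D -> measurable D' -> measurable_fun setT f -> measurable_fun setT f' ->
  measurable_fun setT (fun x => if `[< D x >] then f x else if `[< D' x >] then f' x else x).
Proof.
move=> mD mD' mf mf' _ V mV; rewrite setTI.
have mfV := mf measurableT V mV; have mfV' := mf' measurableT V mV.
rewrite !setTI in mfV mfV'.
rewrite (_ : _ @^-1` V = (D `&` f @^-1` V) `|` (~` D `&` ((D' `&` f' @^-1` V) `|`
   (~` D' `&` V)))).
  apply: measurableU; first exact: measurableI.
  apply: measurableI; first exact: measurableC.
  apply: measurableU; first exact: measurableI.
  by apply: measurableI => //; exact: measurableC.
apply/seteqP; split => x /=.
  case: asboolP => [Dx ?|nDx]; first by left.
  by case: asboolP => [Dx' ?|nDx' ?]; right; split => //; [left|right].
case: asboolP => [Dx [[]|[]]//|nDx [[]//|[_]]].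
by case: asboolP => [Dx' [[]|[]]|nDx' [[]|[]]].
Qed.

(** The involutions are required to preserve the classes at every point, so
    that they belong to the full group, compose and translate sections without
    exceptional sets. *)
Record orbit_enumeration (g : nat -> X -> X) : Prop := OrbitEnumeration {
  enum0 : g 0%N = id;
  enum_measurable : forall n, measurable_fun setT (g n);
  enumK : forall n x, g n (g n x) = x;
  enum_rel : forall n x, Rel (x, g n x);
  enum_cover : {ae mu, forall x, forall y, Rel (x, y) -> exists n, y = g n x}
}.

(** Cover Rel by graphs of maps f_n.  On the set D where f_m is inverse to
    f_n, the map f_n is injective; if moreover D lies in B_k and its image
    outside, then exchanging D and its image is an involution.  The image is
    the set D' of the points that f_m sends into D and f_n sends back, so its
    measurability needs no theorem on images.  A pair x <> y of related points
    lies in such a graph because a separating sequence B distinguishes x from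
    y, and because f_m reaches x from y when y also belongs to the conull set
    where the maps cover the class. *)
Theorem feldman_moore : exists g, orbit_enumeration g.
Proof.
have [f [mf hf]] := countable_sections_thin hX (rel_measurable hR) (rel_discrete hR).
have [B [mB sepB]] := separating_sequence hX.
have mid := @measurable_id _ X setT.
have mff n m : measurable_fun setT (fun x => f n (f m x)).
  exact: (measurableT_comp (mf n) (mf m)).
pose D n m k := [set x | [/\ Rel (x, f n x), f m (f n x) = x, B k x & ~ B k (f n x)]].
pose D' n m k := [set y | D n m k (f m y) /\ f n (f m y) = y].
have mD n m k : measurable (D n m k).
  rewrite (_ : D n m k = [set x | Rel (x, f n x)] `&` [set x | f m (f n x) = x] `&`
    (B k `&` ~` (f n @^-1` B k))).
    have mfB := mf n measurableT _ (mB k); rewrite setTI in mfB.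
    apply: measurableI; apply: measurableI => //; last exact: measurableC.
      exact: (measurable_rel_fun (rel_measurable hR)).
    exact: (measurable_eq_fun hX).
  by apply/seteqP; split => x /=; [move=> []|move=> [[? ?] [? ?]]].
have mD' n m k : measurable (D' n m k).
  apply: (@measurableI _ _ (f m @^-1` D n m k)); last exact: (measurable_eq_fun hX).
  by have := mf m measurableT _ (mD n m k); rewrite setTI.
pose h n m k x := if `[< D n m k x >] then f n x else
  if `[< D' n m k x >] then f m x else x.
(* Index 0 is the identity, which covers the diagonal. *)
exists (fun i => if i is j.+1 then
   (if @unpickle (nat * nat * nat)%type j is Some t then h t.1.1 t.1.2 t.2 else id)
   else id).
split => //.
- move=> [//|j]; case: (unpickle j) => [t|//].
  exact: measurable_fun_if3.
- move=> [//|j] x; case: (unpickle j) => [[[n m] k]|//] /=; rewrite /h.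
  case: (asboolP (D n m k x)) => [Dx|nDx].
    have [Rx fx Bx nBx] := Dx.
    rewrite asboolF; last by case.
    by rewrite asboolT//; split => //; rewrite fx.
  case: (asboolP (D' n m k x)) => [[D'x D'x2]|nD'x]; first by rewrite asboolT.
  by rewrite asboolF// asboolF.
- move=> [x|j x]; first exact: rel_refl hR x.
  case: (unpickle j) => [[[n m] k]|] /=; last exact: rel_refl hR x.
  rewrite /h; case: asboolP => [[]//|nDx].
  case: asboolP => [[[Rx _ _ _] e]|_]; last exact: rel_refl hR x.
  by apply: (rel_sym hR); rewrite e in Rx.
- apply: filterS2 hf (ae_saturated hf) => x hx hsat y xy.
  have [->|/eqP yx] := eqVneq y x; first by exists 0%N.
  have [k [Bx By]] := sepB x y (nesym yx).
  have [n yE] := hx y xy; have [m xE] := hsat y xy x (rel_sym hR xy).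
  exists (pickle (n, m, k)).+1; rewrite pickleK /= /h asboolT//.
  by split => //; rewrite -yE.
Qed.

End feldman_moore.

(** * Norms and scalar products *)

(** Scalar products use [conjc], to which the conjugation of an algebraically
    closed field that appears in [sqmodE] reduces. *)
Lemma sqmod_conjc (R : realType) (a : R[i]) : ((sqmod a)%:C)%C = a * conjc a.
Proof. exact: sqmodE. Qed.

Section hilbert_algebra.
Local Open Scope complex_scope.
Variables (R : realType) (H : hilbertSpace R).
Implicit Types u v : H.

Lemma hdot_sym u v : hdot u v = (hdot v u)^*.
Proof. by have := hermC (@hdot R H) u v; rewrite expr0 mul1r. Qed.

Lemma hdot_real u : complex.Im (hdot u u) = 0 :> R.
Proof.
have := congr1 (@complex.Im R) (hdot_sym u u).
by case: (hdot u u) => a b /=; lra.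
Qed.

Lemma hdot_ge0 u : 0 <= complex.Re (hdot u u) :> R.
Proof.
have := dnorm_ge0 (@hdot R H) u.
by move: (hdot_real u); case: (hdot u u) => a b /= ->; rewrite lecR.
Qed.

Lemma hnorm2E u : hnorm u ^+ 2 = complex.Re (hdot u u).
Proof. by rewrite /hnorm /dnorm sqr_sqrtr// hdot_ge0. Qed.

Lemma hdotE u : hdot u u = (hnorm u ^+ 2)%:C.
Proof. by rewrite hnorm2E; move: (hdot_real u); case: (hdot u u) => a b /= ->. Qed.

Lemma hnorm_ge0 u : 0 <= hnorm u. Proof. exact: sqrtr_ge0. Qed.

Lemma hnormB2 u v :
  hnorm (u - v) ^+ 2 = hnorm u ^+ 2 + hnorm v ^+ 2 - 2 * complex.Re (hdot u v).
Proof.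
rewrite !hnorm2E linearBl !linearBr /= (hdot_sym v u).
by case: (hdot u u) (hdot u v) (hdot v v) => [a b] [c e] [f g] /=; ring.
Qed.

Lemma hnormZ2 (a : R[i]) u : hnorm (a *: u) ^+ 2 = sqmod a * hnorm u ^+ 2.
Proof.
rewrite !hnorm2E linearZl_LR linearZr_LR /= mulrA -sqmod_conjc.
by case: (hdot u u) => x y; simpc.
Qed.

Lemma hdot_CauchySchwarz u v : sqmod (hdot u v) <= hnorm u ^+ 2 * hnorm v ^+ 2.
Proof.
have [v0|v0] := eqVneq v 0.
  by rewrite v0 linear0r /sqmod/= expr0n/= addr0 mulr_ge0// sqr_ge0.
have n0 : 0 < hnorm v ^+ 2.
  have := dnorm_gt0 (@hdot R H) v; rewrite v0 hdotE.
  by rewrite ltcR.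
set n := hnorm v ^+ 2 in n0 *; set m := hnorm u ^+ 2.
have := sqr_ge0 (hnorm (n%:C *: u - hdot u v *: v)).
rewrite hnormB2 !hnormZ2 -/n -/m.
have -> : hdot (n%:C *: u) (hdot u v *: v) = n%:C * (hdot u v * conjc (hdot u v)) :> R[i].
  by rewrite linearZl_LR linearZr_LR /= [hdot u v * _]mulrC.
rewrite -sqmod_conjc.
set s := sqmod (hdot u v).
have -> : sqmod n%:C = n ^+ 2 by rewrite /sqmod/= expr0n addr0.
have -> : complex.Re (n%:C * s%:C) = n * s by simpc.
have -> : n ^+ 2 * m + s * n - 2 * (n * s) = n * (m * n - s) by ring.
by rewrite pmulr_rge0// subr_ge0.
Qed.

(** Cauchy-Schwarz for 1 - <u, v> = <v - u, v>. *)
Lemma hdot_unit u v : hnorm v = 1 -> sqmod (1 - hdot u v) <= hnorm (v - u) ^+ 2.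
Proof.
move=> v1; have <- : hdot (v - u) v = 1 - hdot u v.
  by rewrite linearBl /= hdotE v1 expr1n.
by apply: le_trans (hdot_CauchySchwarz _ _) _; rewrite v1 expr1n mulr1.
Qed.

End hilbert_algebra.

Section ell2_norm.
Local Open Scope complex_scope.
Variables (R : realType) (T : choiceType) (D : set T).
Implicit Type f : ell2_space R D.

Lemma ell2_hnorm2 f : hnorm f ^+ 2 = rsum D (fun t => sqmod (ell2_fun f t)).
Proof. by rewrite hnorm2E -[X in complex.Re X]/(ell2_dot f f) ell2_dotE. Qed.

Lemma ell2_hnorm2_esum f :
  (hnorm f ^+ 2)%:E = (\esum_(t in D) (sqmod (ell2_fun f t))%:E)%E.
Proof.
rewrite ell2_hnorm2 rsum_ge0E ?fineK//; last first.
- by move=> t; exact: sqmod_ge0.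
- exact: ell2_summ.
by apply: summ_fin; [exact: ell2_summ|move=> t; exact: sqmod_ge0].
Qed.

End ell2_norm.

(** * Real functions measurable up to null sets *)

Section ae_real_functions.
Local Open Scope complex_scope.
Variables (R : realType) (d : measure_display) (X : measurableType d).
Variables (mu : probability X R).

Definition ae_real (f : X -> R) : Prop :=
  exists2 g, measurable_fun setT g & {ae mu, forall x, f x = g x}.

Lemma ae_real_meas f : measurable_fun setT f -> ae_real f.
Proof. by move=> mf; exists f => //; exact: aeW. Qed.

Lemma ae_real_eq f f' : {ae mu, forall x, f x = f' x} -> ae_real f' -> ae_real f.
Proof. by move=> ff' [g mg fg]; exists g => //; apply: filterS2 ff' fg => x ->. Qed.

Lemma ae_real_comp1 (F : R -> R) f : measurable_fun setT F -> ae_real f ->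
  ae_real (fun x => F (f x)).
Proof.
move=> mF [g mg fg]; exists (F \o g); first exact: measurableT_comp.
by apply: filterS fg => x /= ->.
Qed.

Lemma ae_real_comp2 (F : R -> R -> R) f1 f2 :
  (forall g1 g2 : X -> R, measurable_fun setT g1 -> measurable_fun setT g2 ->
     measurable_fun setT (fun x => F (g1 x) (g2 x))) ->
  ae_real f1 -> ae_real f2 -> ae_real (fun x => F (f1 x) (f2 x)).
Proof.
move=> mF [g1 m1 h1] [g2 m2 h2]; exists (fun x => F (g1 x) (g2 x)); first exact: mF.
by apply: filterS2 h1 h2 => x /= -> ->.
Qed.

Lemma ae_realD f1 f2 : ae_real f1 -> ae_real f2 -> ae_real (fun x => f1 x + f2 x).
Proof. by apply: (@ae_real_comp2 +%R) => g1 g2; exact: measurable_funD. Qed.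

Lemma ae_realB f1 f2 : ae_real f1 -> ae_real f2 -> ae_real (fun x => f1 x - f2 x).
Proof. by apply: (@ae_real_comp2 (fun a b => a - b)) => g1 g2; exact: measurable_funB. Qed.

Lemma ae_realM f1 f2 : ae_real f1 -> ae_real f2 -> ae_real (fun x => f1 x * f2 x).
Proof. by apply: (@ae_real_comp2 *%R) => g1 g2; exact: measurable_funM. Qed.

Lemma ae_real_sum k (f : 'I_k -> X -> R) : (forall i, ae_real (f i)) ->
  ae_real (fun x => \sum_(i < k) f i x).
Proof.
elim: k f => [|k IH] f hf.
  by under eq_fun do rewrite big_ord0; apply: ae_real_meas; exact: measurable_cst.
under eq_fun do rewrite big_ord_recr /=.
by apply: ae_realD => //; exact: IH.
Qed.

Lemma ae_real_gt (c : R) f : ae_real f -> exists2 T, measurable T &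
  {ae mu, forall x, T x <-> c < f x}.
Proof.
move=> [g mg fg]; exists [set x | c < g x].
  have := @measurable_fun_ltr _ _ _ setT _ _ (@measurable_cst _ _ X R setT c) mg.
  by move=> /(_ measurableT [set true] I); rewrite setTI.
by apply: filterS fg => x ->.
Qed.

Lemma ae_real_if (D : set X) f1 f2 : measurable D -> ae_real f1 -> ae_real f2 ->
  ae_real (fun x => if `[< D x >] then f1 x else f2 x).
Proof.
move=> mD h1 h2; apply: (@ae_real_eq _ (fun x => \1_D x * f1 x + \1_(~` D) x * f2 x)).
  apply: aeW => x; rewrite !indicE in_setC; case: asboolP => Dx.
    by rewrite mem_set// mul1r mul0r addr0.
  by rewrite memNset// mul1r mul0r add0r.
by apply: ae_realD; apply: ae_realM => //; apply: ae_real_meas;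
  apply: measurable_indic => //; exact: measurableC.
Qed.

(** The extended-real sum of the measurable representatives is measurable, and
    it is finite wherever it agrees with h. *)
Lemma ae_real_series (f : nat -> X -> R) (h : X -> R) :
  (forall n, ae_real (f n)) -> (forall n x, 0 <= f n x) ->
  {ae mu, forall x, (h x)%:E = (\sum_(n <oo) (f n x)%:E)%E} -> ae_real h.
Proof.
move=> hf f0 hh.
have /choice[g hg] n : exists g : X -> R, measurable_fun setT g /\ (forall x, 0 <= g x) /\
    {ae mu, forall x, f n x = g x}.
  have [g mg fg] := hf n; exists (fun x => `|g x|); split; last split => //.
    exact: measurableT_comp.
  by apply: filterS fg => x E; rewrite -E ger0_norm.
exists (fun x => fine (\sum_(n <oo) (g n x)%:E)%E).
  apply: measurableT_comp; first exact: fine_measurable.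
  apply: ge0_emeasurable_sum => [n x _ _|n _]; first by rewrite lee_fin (hg n).2.1.
  by apply/measurable_EFinP; exact: (hg n).1.
have : {ae mu, forall x, forall n, f n x = g n x}.
  by apply: ae_foralln => n; exact: (hg n).2.2.
apply: filterS2 hh => x hx fg; under eq_eseriesr do rewrite -fg.
by rewrite -hx.
Qed.

Lemma ae_measurableP (f : X -> R[i]) : ae_measurable mu f <->
  ae_real (fun x => complex.Re (f x)) /\ ae_real (fun x => complex.Im (f x)).
Proof.
split.
  move=> [g [mr mi] fg]; split.
    by exists (fun x => complex.Re (g x)) => //; apply: filterS fg => x ->.
  by exists (fun x => complex.Im (g x)) => //; apply: filterS fg => x ->.
move=> [[g mg fg] [h mh fh]]; exists (fun x => g x +i* h x) => //.
by apply: filterS2 fg fh => x; case: (f x) => a b /= -> ->.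
Qed.

Lemma ae_measurable_real (f : X -> R) : ae_real f -> ae_measurable mu (fun x => (f x)%:C).
Proof.
by move=> hf; apply/ae_measurableP; split => //=; apply: ae_real_meas;
  exact: measurable_cst.
Qed.

Lemma ae_measurable_sqmod (f : X -> R[i]) : ae_measurable mu f ->
  ae_real (fun x => sqmod (f x)).
Proof.
move=> /ae_measurableP[hr hi].
by apply: ae_realD; under eq_fun do rewrite expr2; exact: ae_realM.
Qed.

Lemma ae_measurableM (f1 f2 : X -> R[i]) : ae_measurable mu f1 ->
  ae_measurable mu f2 -> ae_measurable mu (fun x => f1 x * f2 x).
Proof.
move=> /ae_measurableP[r1 i1] /ae_measurableP[r2 i2]; apply/ae_measurableP; split.
  apply: (@ae_real_eq _ (fun x => complex.Re (f1 x) * complex.Re (f2 x) -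
    complex.Im (f1 x) * complex.Im (f2 x))).
    by apply: aeW => x; case: (f1 x) (f2 x) => ? ? [].
  by apply: ae_realB; exact: ae_realM.
apply: (@ae_real_eq _ (fun x => complex.Re (f1 x) * complex.Im (f2 x) +
    complex.Im (f1 x) * complex.Re (f2 x))).
  by apply: aeW => x; case: (f1 x) (f2 x) => ? ? [].
by apply: ae_realD; exact: ae_realM.
Qed.

Lemma ae_measurableB (f1 f2 : X -> R[i]) : ae_measurable mu f1 ->
  ae_measurable mu f2 -> ae_measurable mu (fun x => f1 x - f2 x).
Proof.
move=> /ae_measurableP[r1 i1] /ae_measurableP[r2 i2]; apply/ae_measurableP; split.
  apply: (@ae_real_eq _ (fun x => complex.Re (f1 x) - complex.Re (f2 x))).
    by apply: aeW => x; case: (f1 x) (f2 x) => ? ? [].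
  exact: ae_realB.
apply: (@ae_real_eq _ (fun x => complex.Im (f1 x) - complex.Im (f2 x))).
  by apply: aeW => x; case: (f1 x) (f2 x) => ? ? [].
exact: ae_realB.
Qed.

End ae_real_functions.

(** * Sections of the quotient field *)

Section quotient_sections.
Local Open Scope complex_scope.
Variables (R : realType) (d : measure_display) (X : measurableType d).
Variables (mu : probability X R) (Rel S : set (X * X)).
Hypothesis hX : standard_borel X R.
Hypothesis hR : pmp_relation mu Rel.
Hypothesis hS : pmp_relation mu S.
Variable g : nat -> X -> X.
Hypothesis hg : orbit_enumeration mu Rel g.

Lemma ae_g (Q : X -> Prop) j : {ae mu, forall x, Q x} -> {ae mu, forall x, Q (g j x)}.
Proof.
move=> /(ae_saturated hX hR); apply: filterS => x; apply; exact: (enum_rel hg).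
Qed.

Lemma ae_real_g (f : X -> R) j : ae_real mu f -> ae_real mu (fun x => f (g j x)).
Proof.
move=> [h mh fh]; exists (h \o g j).
  exact: (measurableT_comp mh (enum_measurable hg j)).
exact: ae_g fh.
Qed.

Lemma ae_measurable_g (f : X -> R[i]) j : ae_measurable mu f ->
  ae_measurable mu (fun x => f (g j x)).
Proof.
by move=> /ae_measurableP[hr hi]; apply/ae_measurableP; split;
  [exact: (ae_real_g _ hr)|exact: (ae_real_g _ hi)].
Qed.

(** Measurability of a section is tested on the full group.  Compositions are
    needed to evaluate the translate of a section by [g j] at [g n x]. *)
Lemma full_group_gg n j : full_group mu Rel (fun x => g n (g j x)).
Proof.
split.
- exact: (measurableT_comp (enum_measurable hg n) (enum_measurable hg j)).
- exists (fun x => g j (g n x)).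
    exact: (measurableT_comp (enum_measurable hg j) (enum_measurable hg n)).
  by split => x; rewrite !(enumK hg).
- by apply: aeW => x; apply: (rel_trans hR (enum_rel hg j x)); exact: (enum_rel hg).
Qed.

Lemma full_group_g n : full_group mu Rel (g n).
Proof. by have := full_group_gg n 0; rewrite (enum0 hg). Qed.

Lemma relclass_eq x y : S (x, y) -> relclass S x = relclass S y.
Proof.
move=> xy; apply/seteqP; split => z /= h.
  exact: (rel_trans hS (rel_sym hS xy)).
exact: (rel_trans hS xy).
Qed.

Lemma relclass_eqP x y : relclass S x = relclass S y -> S (x, y).
Proof. by move=> e; rewrite -[S _]/(relclass S x y) e; exact: rel_refl hS y. Qed.

(** Keeping only the first index that reaches each S-class enumerates the
    quotient without repetition. *)
Definition fresh (n : nat) : set X :=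
  [set x | forall m, (m < n)%N -> ~ S (g m x, g n x)].

Lemma measurable_fresh n : measurable (fresh n).
Proof.
rewrite (_ : fresh n = \bigcap_(m in [set m | (m < n)%N]) ~` [set x | S (g m x, g n x)]).
  apply: bigcap_measurableType => m _; apply: measurableC.
  exact: (measurable_rel_fun (rel_measurable hS) (enum_measurable hg m)
    (enum_measurable hg n)).
by apply/seteqP; split => x h m /=; exact: h.
Qed.

Lemma hnorm2_series x : (forall y, Rel (x, y) -> exists n, y = g n x) ->
  forall u : ell2_space R (quotient Rel S x),
  (hnorm u ^+ 2)%:E = (\sum_(n <oo) (if `[< fresh n x >] then
     sqmod (ell2_fun u (relclass S (g n x))) else 0)%:E)%E.
Proof.
move=> hx u; rewrite ell2_hnorm2_esum; move: (ell2_fun u) => f.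
have -> : quotient Rel S x =
    (fun n => relclass S (g n x)) @` [set n | fresh n x].
  apply/seteqP; split => [_ [y /hx[n ->] <-]|_ [n _ <-]]; last first.
    by exists (g n x) => //; exact: (enum_rel hg).
  have ex : exists m, `[< S (g m x, g n x) >].
    by exists n; apply/asboolP; exact: (rel_refl hS).
  have [m /asboolP Sm hm] := ex_minnP ex.
  exists m => /=; last exact: relclass_eq.
  move=> j jm Sj; have : (m <= j)%N.
    by apply: hm; apply/asboolP; exact: (rel_trans hS Sj Sm).
  by rewrite leqNgt jm.
rewrite (esum_set_image (fun t => (sqmod (f t))%:E)); last 2 first.
- by move=> n _; rewrite lee_fin sqmod_ge0.
- move=> n m /set_mem fn /set_mem fm /relclass_eqP Snm.
  have [nm|mn|//] := ltngtP n m; first by have := fm _ nm Snm.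
  by have := fn _ mn (rel_sym hS Snm).
rewrite eseries_mkcond; apply: eq_eseriesr => n _.
rewrite (_ : (n \in _) = `[< fresh n x >]); first by case: ifP.
by apply/idP/asboolP => [/set_mem//|?]; exact: mem_set.
Qed.

Lemma ae_real_hnorm2 (u : forall x, ell2_space R (quotient Rel S x)) :
  (forall n, ae_measurable mu (fun x => ell2_fun (u x) (relclass S (g n x)))) ->
  ae_real mu (fun x => hnorm (u x) ^+ 2).
Proof.
move=> hu; apply: (@ae_real_series _ _ _ _ (fun n x => if `[< fresh n x >] then
     sqmod (ell2_fun (u x) (relclass S (g n x))) else 0)).
- move=> n; apply: ae_real_if; first exact: measurable_fresh.
    exact: ae_measurable_sqmod.
  by apply: ae_real_meas; exact: measurable_cst.
- by move=> n x; case: ifP => // _; exact: sqmod_ge0.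
- by apply: filterS (enum_cover hg) => x hx; exact: hnorm2_series.
Qed.

Lemma meas_section_hnorm2 (xi : forall x, quotient_field mu Rel S x) :
  meas_section (quotient_field mu Rel S) xi -> ae_real mu (fun x => hnorm (xi x) ^+ 2).
Proof. by move=> hxi; apply: ae_real_hnorm2 => n; apply: hxi; exact: full_group_g. Qed.

(** Since [g j] is an involution, the value of the translated section at the
    class of [g n x] is the value of the section at the class of
    [g n (g j y)], where y = [g j x]. *)
Lemma ae_real_hnorm2_diff (xi : forall x, quotient_field mu Rel S x) j :
  meas_section (quotient_field mu Rel S) xi ->
  ae_real mu (fun x => hnorm (xi x - quotient_map hR (enum_rel hg j x) (xi (g j x))) ^+ 2).
Proof.
move=> hxi; apply: ae_real_hnorm2 => n.
have h1 := hxi _ (full_group_g n).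
have h2 := ae_measurable_g j (hxi _ (full_group_gg n j)).
have := ae_measurableB h1 h2; congr (ae_measurable mu _).
by apply/funext => x; rewrite (enumK hg).
Qed.

End quotient_sections.

(** * The measure of subsets of a relation *)

Section rel_measure_bounds.
Variables (R : realType) (d : measure_display) (X : measurableType d).
Variables (mu : probability X R).
Hypothesis hX : standard_borel X R.

Lemma measurable_singleton (y : X) : measurable [set y].
Proof.
exact: (measurable_eq_fun hX (@measurable_id _ _ _) (@measurable_cst _ _ _ _ setT y)).
Qed.

Lemma le_counting (A B : set X) : A `<=` B -> (counting A <= counting B :> \bar R)%E.
Proof.
move=> AB; rewrite /counting; case: (asboolP (finite_set B)) => fB; last exact: leey.
have fA := sub_finite_set AB fB; rewrite asboolT// lee_fin ler_nat.
by apply: finmap.fsubset_leq_card; rewrite -fset_set_sub.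
Qed.

Lemma counting_set1 (y : X) : counting [set y] = 1%E :> \bar R.
Proof. by rewrite /counting asboolT// fset_set1 finmap.cardfs1. Qed.

Lemma counting_set0 : counting (set0 : set X) = 0%E :> \bar R.
Proof. by rewrite /counting asboolT// fset_set0. Qed.

Section points.
Variables (g : nat -> X) (I : set nat).

Let F n : set X := if n \in I then [set g n] else set0.

Let mF n : measurable (F n).
Proof. by rewrite /F; case: ifP => // _; exact: measurable_singleton. Qed.

Let countF n : counting (F n) = (\1_I n)%:E :> \bar R.
Proof.
by rewrite /F indicE; case: ifP => _; [exact: counting_set1|exact: counting_set0].
Qed.

Lemma counting_le_points (A : set X) : (forall y, A y -> exists2 n, I n & y = g n) ->
  (counting A <= \sum_(n <oo) (\1_I n)%:E :> \bar R)%E.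
Proof.
move=> AI; have mU : measurable (\bigcup_n F n) by exact: bigcup_measurable.
apply: (@le_trans _ _ (counting (\bigcup_n F n))).
  apply: le_counting => y /AI[n In ->]; exists n => //.
  by rewrite /F mem_set.
under eq_eseriesr do rewrite -countF.
exact: measure_sigma_subadditive.
Qed.

Lemma points_le_counting (A : set X) : (forall n, I n -> A (g n)) ->
  (forall m n, I m -> I n -> g m = g n -> m = n) ->
  (\sum_(n <oo) (\1_I n)%:E <= counting A :> \bar R)%E.
Proof.
move=> IA inj; have mU : measurable (\bigcup_n F n) by exact: bigcup_measurable.
apply: (@le_trans _ _ (counting (\bigcup_n F n))); last first.
  by apply: le_counting => y [n _]; rewrite /F; case: ifP => // /set_mem /IA + ->.
under eq_eseriesr do rewrite -countF.
rewrite [leRHS]measure_semi_bigcup//.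
move=> m n _ _ [y []]; rewrite /F; case: ifP => // /set_mem Im -> .
by case: ifP => // /set_mem In /inj; apply.
Qed.

End points.

Lemma integral_indic_series (M : nat -> set X) : (forall n, measurable (M n)) ->
  (\int[mu]_x (\sum_(n <oo) (\1_(M n) x)%:E) = \sum_(n <oo) mu (M n))%E.
Proof.
move=> mM; rewrite integral_nneseries//; last first.
  by move=> n; apply/measurable_EFinP; exact: measurable_indic.
by apply: eq_eseriesr => n _; rewrite integral_indic// setIT.
Qed.

(** The section of E at x has at most one point for each n with x in M n,
    except over a null set, where it is bounded by +oo. *)
Lemma rel_measure_le_series (g : nat -> X -> X) (M : nat -> set X) (E : set (X * X)) :
  (forall n, measurable (M n)) ->
  {ae mu, forall x, forall y, E (x, y) -> exists2 n, M n x & y = g n x} ->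
  (rel_measure mu E <= \sum_(n <oo) mu (M n))%E.
Proof.
move=> mM [N [mN N0 EN]]; rewrite -integral_indic_series//.
(* On N the sum of the indicators may be too small; +oo is added there, at no
   cost for the integral. *)
pose h := ((fun=> +oo%E) : X -> \bar R) \_ N.
have h0 x : (0 <= h x)%E by rewrite /h patchE; case: ifP.
have ih : (\int[mu]_x h x = 0)%E.
  rewrite -integral_mkcond integral_cst// [X in (_ * X)%E](_ : _ = 0%E) ?mule0//.
have mh : measurable_fun setT h.
  by apply/(measurable_restrictT _ mN); exact: measurable_cst.
have ms : measurable_fun setT (fun x => (\sum_(n <oo) (\1_(M n) x)%:E)%E : \bar R).
  apply: ge0_emeasurable_sum => [n x _ _|n _]; first by rewrite lee_fin.
  by apply/measurable_EFinP; exact: measurable_indic.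
apply: (@le_trans _ _ (\int[mu]_x (\sum_(n <oo) (\1_(M n) x)%:E + h x))%E); last first.
  rewrite ge0_integralD// ?ih ?adde0// => x _.
  by apply: nneseries_ge0 => n _ _; rewrite lee_fin.
apply: le_integral_nonmeasurable => x; first exact: counting_ge0.
have s0 : (0 <= \sum_(n <oo) (\1_(M n) x)%:E :> \bar R)%E.
  by apply: nneseries_ge0 => n _ _; rewrite lee_fin.
have [Nx|Nx] := pselect (N x).
  by rewrite /h patchE mem_set// addey ?leey// gt_eqF// (lt_le_trans _ s0)// ltNy0.
apply: (@le_trans _ _ (\sum_(n <oo) (\1_(M n) x)%:E)%E); last by rewrite leeDl.
rewrite (eq_eseriesr (g := fun n => (\1_[set n | M n x] n)%:E)); last first.
  by move=> n _; rewrite !indicE; congr ((nat_of_bool _)%:R%:E);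
    apply/idP/idP => /set_mem ?; exact: mem_set.
apply: (@counting_le_points (g ^~ x)) => y Exy.
have : ~ (~` [set x | forall y, E (x, y) -> exists2 n, M n x & y = g n x]) x.
  by move=> /EN.
by move=> /contrapT /(_ y Exy).
Qed.

Lemma rel_measure_ge_series (g : nat -> X -> X) (M : nat -> set X) (E : set (X * X)) :
  (forall n, measurable (M n)) -> (forall n x, M n x -> E (x, g n x)) ->
  (forall x m n, M m x -> M n x -> g m x = g n x -> m = n) ->
  (\sum_(n <oo) mu (M n) <= rel_measure mu E)%E.
Proof.
move=> mM ME inj; rewrite -integral_indic_series//.
apply: le_integral_nonmeasurable => x.
  by apply: nneseries_ge0 => n _ _; rewrite lee_fin.
rewrite (eq_eseriesr (g := fun n => (\1_[set n | M n x] n)%:E)); last first.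
  by move=> n _; rewrite !indicE; congr ((nat_of_bool _)%:R%:E);
    apply/idP/idP => /set_mem ?; exact: mem_set.
apply: (@points_le_counting (g ^~ x)); first by move=> n; exact: ME.
by move=> m n /= Mm Mn; exact: inj.
Qed.

(** A null set of base points is a null set for [rel_measure], even if the
    sections above it are uncountable, since 0 times +oo is 0. *)
Lemma ae_rel_of_ae (Q : X * X -> Prop) :
  {ae mu, forall x, forall y, Q (x, y)} -> {ae rel_measure mu, forall z, Q z}.
Proof.
move=> [N [mN N0 QN]]; exists (N `*` setT); split.
- exact: measurableX.
- by apply: (rel_measure_null_base mN N0) => x y [].
- by move=> [x y] /= nQ; split => //; apply: QN => /= /(_ y).
Qed.

Lemma ae_of_ae_rel (g : X -> X) (Q : X * X -> Prop) : measurable_fun setT g ->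
  {ae rel_measure mu, forall z, Q z} -> {ae mu, forall x, Q (x, g x)}.
Proof.
move=> mg [A [mA A0 QA]]; exists [set x | A (x, g x)].
have mT := measurable_rel_fun mA (@measurable_id _ _ _) mg.
split=> //; last by move=> x; exact: QA.
apply/eqP; rewrite eq_le measure_ge0 andbT -A0.
by apply: rel_measure_ge => // x Ax; exists (g x).
Qed.

(** Continuity from above, applied to the tails of the sequence T. *)
Lemma measure_eventually_small (T : nat -> set X) (e : R) : 0 < e ->
  (forall k, measurable (T k)) ->
  {ae mu, forall x, exists K, forall k, (K <= k)%N -> ~ T k x} ->
  exists k, (mu (T k) < e%:E)%E.
Proof.
move=> e0 mT hT.
have mU n : measurable (\bigcup_(k >= n) T k) by exact: bigcup_measurable.
have : mu (lim_sup_set T) = 0%E.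
  apply: measure_negligible.
    by apply: bigcap_measurableType => n _; exact: mU.
  apply: negligibleS hT => x hx /= -[K hK].
  by have [k /= Kk Tk] := hx K I; exact: hK Tk.
have := @lim_sup_set_cvg _ _ _ mu T mT.
have fin : (mu (\bigcup_(k >= 0) T k) < +oo)%E.
  by apply: (le_lt_trans (probability_le1 mu (mU 0%N))); exact: ltry.
move=> /(_ fin) + h0; rewrite [X in _ --> X]h0 => hc.
have : \forall n \near \oo, (mu (\bigcup_(k >= n) T k) < e%:E)%E.
  by apply: (hc [set u | (u < e%:E)%E]); apply: open_ereal_lt'; rewrite lte_fin.
move=> [n _ /(_ n (leqnn n))] /= hn; exists n; apply: le_lt_trans hn.
apply: le_measure; [exact: mem_set|exact: mem_set (mU n)|].
by move=> x Tx; exists n => /=.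
Qed.

(** Dominated convergence for a series of sets: the tail of the series is
    small uniformly in k, and finitely many terms are small for large k. *)
Lemma series_measure_small (N : nat -> set X) (T : nat -> nat -> set X) (e : R) :
  0 < e -> (forall n, measurable (N n)) -> (forall k n, measurable (T k n)) ->
  (\sum_(n <oo) mu (N n) < +oo)%E ->
  {ae mu, forall x, forall n, exists K, forall k, (K <= k)%N -> ~ T k n x} ->
  exists k, (\sum_(n <oo) mu (N n `&` T k n) < e%:E)%E.
Proof.
move=> e0 mN mT Nfin hT.
have e2 : 0 < e / 2 by rewrite divr_gt0.
have tail := nneseries_tail_cvg Nfin (fun k _ => measure_ge0 mu (N k)).
have : \forall J \near \oo, (\sum_(J <= k <oo) mu (N k) < (e / 2)%:E)%E.
  by apply: (tail [set u | (u < (e / 2)%:E)%E]); apply: open_ereal_lt'; rewrite lte_fin.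
move=> [J _ /(_ J (leqnn J))] /= hJ.
pose U k := \bigcup_(n in [set n | (n < J)%N]) T k n.
have eJ : 0 < e / 2 / J.+1%:R by rewrite divr_gt0.
have [k hk] : exists k, (mu (U k) < (e / 2 / J.+1%:R)%:E)%E.
  apply: measure_eventually_small => //; first by move=> k; exact: bigcup_measurable.
  apply: filterS hT => x /choice[K hK].
  exists (\max_(n < J) K n)%N => k Kk [n /= nJ]; apply: hK.
  by apply: leq_trans Kk; exact: (leq_bigmax (Ordinal nJ)).
exists k; rewrite (nneseries_split _ J); last by move=> n _; exact: measure_ge0.
rewrite [e in ltRHS]splitr EFinD add0n; apply: lteD; last first.
  apply: le_lt_trans hJ; apply: lee_nneseries => n _ //.
  by apply: le_measure; rewrite ?inE//; exact: measurableI.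
apply: (@le_lt_trans _ _ (\sum_(0 <= n < J) (e / 2 / J.+1%:R)%:E)%E).
  rewrite big_nat [leRHS]big_nat; apply: lee_sum => n /andP[_ nJ].
  apply: le_trans (ltW hk); apply: le_measure; rewrite ?inE//.
  - exact: measurableI.
  - exact: bigcup_measurable.
  - by move=> x [_ Tx]; exists n.
rewrite sumEFin lte_fin sumr_const_nat subn0 -[ltLHS]mulr_natr.
rewrite -[ltLHS]mulrA gtr_pMr// mulrC ltr_pdivrMr// mul1r.
by rewrite ltr_nat.
Qed.

End rel_measure_bounds.

(** * From coamenability to weak containment *)

Section coamenable_weakly_contained.
Local Open Scope complex_scope.
Variables (R : realType) (d : measure_display) (X : measurableType d).
Variables (mu : probability X R) (Rel S : set (X * X)).
Hypothesis hX : standard_borel X R.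
Hypothesis hR : pmp_relation mu Rel.
Hypothesis hS : pmp_relation mu S.

Lemma sqmod_norm_gt (e : R) (w : R[i]) : 0 < e -> (e%:C < `|w|) -> e ^+ 2 < sqmod w.
Proof.
move=> e0; rewrite normc_def ltcR => h.
rewrite -[ltRHS]sqr_sqrtr ?sqmod_ge0// ltr_pXn2r ?nnegrE ?sqrtr_ge0 ?(ltW e0)//.
Qed.

Lemma sqmod_conj (w : R[i]) : sqmod (conjc w) = sqmod w.
Proof. by case: w => a b; rewrite /sqmod/= sqrrN. Qed.

Lemma quotient_hnorm (x y : X) (xy : Rel (x, y)) (u : quotient_field mu Rel S y) :
  hnorm (quotient_map hR xy u) = hnorm u.
Proof.
have [_ U _] := ell2_cast_unitary R (quotient_eq S hR xy).
by rewrite /hnorm /dnorm (U u u).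
Qed.

(** One section suffices: the given section of scalars times an almost
    invariant unit section of large index. *)
Lemma coamenable_weakly_contained :
  coamenable S hR -> weakly_contained (scalar_rep mu Rel) (quotient_rep S hR).
Proof.
move=> [xi [L2xi unit_xi conv_xi]] Q mQ QR Qfin f mf e e0.
have [g hg] := feldman_moore hX hR.
have mid := @measurable_id _ X setT.
(* Keeping the first index that reaches each point of the section of Q makes
   the pieces N n disjoint, so that their measures add up to that of Q. *)
pose N n := [set x | Q (x, g n x) /\ forall m, (m < n)%N -> g m x <> g n x].
have mN n : measurable (N n).
  rewrite (_ : N n = [set x | Q (x, g n x)] `&`
      \bigcap_(m in [set m | (m < n)%N]) ~` [set x | g m x = g n x]).
    apply: measurableI; first exact: (measurable_rel_fun mQ mid (enum_measurable hg n)).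
    apply: bigcap_measurableType => m _; apply: measurableC.
    exact: (measurable_eq_fun hX (enum_measurable hg m) (enum_measurable hg n)).
  by apply/seteqP; split => x [Qx hx]; split => // m mn; exact: hx.
have Nfin : (\sum_(n <oo) mu (N n) < +oo)%E.
  apply: le_lt_trans Qfin; apply: (@rel_measure_ge_series _ _ _ mu hX g) => //.
    by move=> n x [].
  move=> x m n [_ hm] [_ hn] gmn.
  have [mn|nm|//] := ltngtP m n; first by have := hn _ mn gmn.
  by have := hm _ nm (esym gmn).
pose psi k n x : R := sqmod (f (g n x) : R[i]) * sqmod (f x : R[i]) *
  hnorm (xi k x - quotient_map hR (enum_rel hg n x) (xi k (g n x))) ^+ 2.
have mpsi k n : ae_real mu (psi k n).
  apply: ae_realM; last first.
    by apply: ae_real_hnorm2_diff => //; exact: (L2xi k).1.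
  apply: ae_realM; last exact: ae_measurable_sqmod.
  pose f' : X -> R[i] := f; have mf' : ae_measurable mu f' := mf.
  have h := ae_real_g hX hR hg n (ae_measurable_sqmod mf'); exact: h.
have /choice[T hT] (kn : nat * nat) : exists T, measurable T /\
    {ae mu, forall x, T x <-> e ^+ 2 < psi kn.1 kn.2 x}.
  by have [T mT hT] := ae_real_gt (e ^+ 2) (mpsi kn.1 kn.2); exists T.
have hTae : {ae mu, forall x, forall kn, T kn x <-> e ^+ 2 < psi kn.1 kn.2 x}.
  by apply: ae_forall_count => kn; exact: (hT kn).2.
have conv_g : {ae mu, forall x, forall n,
    hnorm (xi k x - quotient_map hR (enum_rel hg n x) (xi k (g n x))) @[k --> \oo] --> (0 : R)}.
  apply: ae_foralln => n.
  have := ae_of_ae_rel (enum_measurable hg n) conv_xi.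
  by apply: filterS => x /(_ (enum_rel hg n x)).
have evT : {ae mu, forall x, forall n, exists K, forall k, (K <= k)%N -> ~ T (k, n) x}.
  apply: filterS2 hTae conv_g => x hx cx n.
  have h2 : psi k n x @[k --> \oo] --> (0 : R).
    have := cvgM (cvg_cst (sqmod (f (g n x) : R[i]) * sqmod (f x : R[i])))
      (cvgM (cx n) (cx n)).
    by rewrite !mulr0; exact.
  have : \forall k \near \oo, psi k n x < e ^+ 2.
    by apply: (cvgr_lt _ h2); rewrite exprn_gt0.
  move=> [K _ hK]; exists K => k /hK /= h /hx /=.
  by move=> h'; have := lt_trans h h'; rewrite ltxx.
have [k hk] := @series_measure_small _ _ _ mu N (fun k n => T (k, n)) e e0 mN
   (fun k n => (hT (k, n)).1) Nfin evT.
exists 1%N, (fun (_ : 'I_1) x => (f x : R[i]) *: xi k x); split.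
  move=> _ gamma hgamma.
  by apply: ae_measurableM => //; exact: (L2xi k).1.
apply: le_lt_trans hk; apply: (@rel_measure_le_series _ _ _ mu hX g).
  by move=> n; apply: measurableI => //; exact: (hT (k, n)).1.
have unit_k := unit_xi k.
apply: filterS2 (filterI (enum_cover hg) unit_k) hTae => x [hx ux] Tx y [/= Qxy [xy]].
have ex : exists m, g m x == y.
  by have [m ->] := hx y (QR _ Qxy); exists m.
have [n /eqP yn nmin] := ex_minnP ex.
subst y => big; exists n => //; split.
  split => // m mn /eqP/nmin; by rewrite leqNgt mn.
apply/(Tx (k, n)) => /=.
move: big; rewrite big_ord1 => /(sqmod_norm_gt e0) big; apply: (lt_le_trans big).
have -> : xy = enum_rel hg n x by exact: Prop_irrelevance.
have -> : quotient_map (S := S) hR (enum_rel hg n x) ((f (g n x) : R[i]) *: xi k (g n x)) =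
    (f (g n x) : R[i]) *: quotient_map hR (enum_rel hg n x) (xi k (g n x)) by exact: val_inj.
set U := quotient_map hR (enum_rel hg n x) _; set V := xi k x.
set a : R[i] := f (g n x); set b : R[i] := f x.
have -> : scalar_dot a b - ell2_dot (a *: U) (b *: V) =
    a * conjc b * (1 - hdot (U : ell2_space R _) V).
  rewrite mulrBr mulr1; congr (_ - _).
  rewrite -[LHS]/(hdot ((a *: U) : ell2_space R _) (b *: V)).
  by rewrite linearZl_LR linearZr_LR /= mulrA.
rewrite /psi !sqmodM sqmod_conj; apply: ler_wpM2l; last exact: hdot_unit.
by rewrite mulr_ge0// sqmod_ge0.
Qed.

End coamenable_weakly_contained.

(** * Square roots of sums of squared moduli *)

Section square_root_inequalities.
Local Open Scope complex_scope.
Variable R : realType.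
Implicit Types p q a b : R.

Lemma sqrt_CauchySchwarz p q a b : 0 <= p -> 0 <= q -> 0 <= a -> 0 <= b ->
  Num.sqrt p * Num.sqrt q + Num.sqrt a * Num.sqrt b <=
  Num.sqrt (p + a) * Num.sqrt (q + b).
Proof.
move=> p0 q0 a0 b0.
rewrite -(@ler_pXn2r _ 2) ?nnegrE ?addr_ge0 ?mulr_ge0 ?sqrtr_ge0//.
rewrite exprMn !sqr_sqrtr ?addr_ge0//.
rewrite -{2}(sqr_sqrtr p0) -{2}(sqr_sqrtr q0) -{2}(sqr_sqrtr a0) -{2}(sqr_sqrtr b0).
set P := Num.sqrt p; set Q := Num.sqrt q; set A := Num.sqrt a; set B := Num.sqrt b.
rewrite -subr_ge0.
have -> : (P ^+ 2 + A ^+ 2) * (Q ^+ 2 + B ^+ 2) - (P * Q + A * B) ^+ 2 =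
  (P * B - A * Q) ^+ 2 by ring.
exact: sqr_ge0.
Qed.

Lemma sqmod_polar (a b : R[i]) :
  sqmod a + sqmod b - sqmod (a - b) <= 2 * (Num.sqrt (sqmod a) * Num.sqrt (sqmod b)).
Proof.
case: a b => [x y] [z t]; rewrite -sqrtrM ?sqmod_ge0// /sqmod/=.
have -> : x ^+ 2 + y ^+ 2 + (z ^+ 2 + t ^+ 2) - ((x - z) ^+ 2 + (y - t) ^+ 2) =
  2 * (x * z + y * t) by ring.
rewrite ler_pM2l//; set s := x * z + y * t.
apply: (le_trans (ler_norm s)); rewrite -sqrtr_sqr ler_sqrt; last first.
  by rewrite mulr_ge0// addr_ge0// sqr_ge0.
rewrite -subr_ge0.
have -> : (x ^+ 2 + y ^+ 2) * (z ^+ 2 + t ^+ 2) - s ^+ 2 = (x * t - y * z) ^+ 2.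
  by rewrite /s; ring.
exact: sqr_ge0.
Qed.

Lemma sum_sqmod_ge0 k (u : 'I_k -> R[i]) : 0 <= \sum_(i < k) sqmod (u i).
Proof. by apply: sumr_ge0 => i _; exact: sqmod_ge0. Qed.

(** The triangle inequality in C^k for the vectors u and v, squared.  Expanding
    the square turns it into a bound from below on the product of the norms,
    which passes from k to k + 1 by [sqrt_CauchySchwarz]. *)
Lemma sqrt_sum_sqmodB k (u v : 'I_k -> R[i]) :
  (Num.sqrt (\sum_(i < k) sqmod (u i)) - Num.sqrt (\sum_(i < k) sqmod (v i))) ^+ 2 <=
  \sum_(i < k) sqmod (u i - v i).
Proof.
suff H : \sum_(i < k) sqmod (u i) + \sum_(i < k) sqmod (v i) -
    \sum_(i < k) sqmod (u i - v i) <=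
    2 * (Num.sqrt (\sum_(i < k) sqmod (u i)) * Num.sqrt (\sum_(i < k) sqmod (v i))).
  rewrite sqrrB !sqr_sqrtr ?sum_sqmod_ge0//; move: H; rewrite -mulr_natl; lra.
elim: k u v => [|k IH] u v; first by rewrite !big_ord0 sqrtr0 mul0r mulr0 subr0 addr0.
rewrite !big_ord_recr /=.
have := IH (fun i => u (widen_ord (leqnSn k) i)) (fun i => v (widen_ord (leqnSn k) i)).
have := sqmod_polar (u ord_max) (v ord_max).
have := @sqrt_CauchySchwarz _ _ _ _
  (sum_sqmod_ge0 (fun i => u (widen_ord (leqnSn k) i)))
  (sum_sqmod_ge0 (fun i => v (widen_ord (leqnSn k) i)))
  (sqmod_ge0 (u ord_max)) (sqmod_ge0 (v ord_max)).
lra.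
Qed.

End square_root_inequalities.

Section ell2_root.
Local Open Scope complex_scope.
Variables (R : realType) (T : choiceType) (D : set T).

Local Notation summ h := (summable D (EFin \o h)).

Lemma summ_sum k (h : 'I_k -> T -> R) : (forall i, summ (h i)) ->
  summ (fun t => \sum_(i < k) h i t) /\
  rsum D (fun t => \sum_(i < k) h i t) = \sum_(i < k) rsum D (h i).
Proof.
elim: k h => [|k IH] h hs.
  rewrite big_ord0; under eq_fun do rewrite big_ord0.
  split; last exact: rsum0.
  by apply/summP; rewrite esum1// => t _; rewrite normr0.
have [s1 s2] := IH (fun i => h (widen_ord (leqnSn k) i)) (fun i => hs _).
under eq_fun do rewrite big_ord_recr /=.
split; first exact: summD.
by rewrite rsumD// s2 big_ord_recr.
Qed.

Lemma le_rsum (h h' : T -> R) : (forall t, 0 <= h t) -> (forall t, h t <= h' t) ->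
  summ h' -> rsum D h <= rsum D h'.
Proof.
move=> h0 hh' sh'.
have sh : summ h by apply: summ_le sh' => t _; rewrite ger0_norm.
have h'0 t : 0 <= h' t by exact: le_trans (hh' t).
rewrite !rsum_ge0E// -lee_fin !fineK ?summ_fin//.
by apply: le_esum => t _; rewrite lee_fin.
Qed.

Section root.
Local Open Scope complex_scope.
Variables (k : nat) (zeta : 'I_k -> ell2_space R D) (c : R).

Definition weight (t : T) : R := \sum_(i < k) sqmod (ell2_fun (zeta i) t).

Lemma weight_ge0 t : 0 <= weight t. Proof. exact: sum_sqmod_ge0. Qed.

Lemma weight_summ : summ weight /\ rsum D weight = \sum_(i < k) hnorm (zeta i) ^+ 2.
Proof.
have [h1 h2] := @summ_sum k (fun i t => sqmod (ell2_fun (zeta i) t))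
  (fun i => ell2_summ (zeta i)).
split => //; rewrite [LHS]h2; apply: eq_bigr => i _; exact: esym (ell2_hnorm2 _).
Qed.

(** Intended for c equal to the sum of the squared norms, which normalises the
    vector. *)
Definition root_fun (t : T) : R[i] := (Num.sqrt (weight t / c))%:C.

Lemma sqmod_root_fun t : 0 < c -> sqmod (root_fun t) = weight t / c.
Proof.
move=> c0; rewrite /root_fun /sqmod /= expr0n /= addr0 sqr_sqrtr//.
by rewrite divr_ge0 ?weight_ge0// ltW.
Qed.

Lemma root_fun_ell2 : 0 < c -> root_fun \in @ell2_pred R T D.
Proof.
move=> c0; apply/asboolP; split.
  move=> t Dt; rewrite /root_fun /weight big1 ?mul0r ?sqrtr0// => i _.
  by rewrite ell2_out// /sqmod/= expr0n addr0.
rewrite (_ : (fun t => _) = fun t => c^-1 * weight t); last first.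
  by apply/funext => t; rewrite sqmod_root_fun// mulrC.
by apply: summZ; exact: weight_summ.1.
Qed.

Definition ell2_root (c0 : 0 < c) : ell2_space R D := Ell2 (root_fun_ell2 c0).

Lemma hnorm_ell2_root (c0 : 0 < c) : c = \sum_(i < k) hnorm (zeta i) ^+ 2 ->
  hnorm (ell2_root c0) = 1.
Proof.
move=> cE; apply/eqP; rewrite -(@eqrXn2 _ 2) ?hnorm_ge0// expr1n ell2_hnorm2.
under eq_fun do rewrite /= sqmod_root_fun// mulrC.
rewrite rsumZ; last exact: weight_summ.1.
by rewrite weight_summ.2 -cE mulVf// gt_eqF.
Qed.

End root.

(** With p, q the square roots of the weights at t and A, B those of a, b,
      (p / A - q / B)^2 = (p - q)^2 / (AB) + (A^-2 - (AB)^-1) p^2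
                          + (B^-2 - (AB)^-1) q^2.
    Summed over t, the last two terms give - (A - B)^2 / (AB), and the first
    is bounded by [sqrt_sum_sqmodB]. *)
Lemma hnorm_ell2_rootB k (zeta eta : 'I_k -> ell2_space R D) (a b : R)
    (a0 : 0 < a) (b0 : 0 < b) :
  a = \sum_(i < k) hnorm (zeta i) ^+ 2 -> b = \sum_(i < k) hnorm (eta i) ^+ 2 ->
  hnorm (ell2_root zeta a0 - ell2_root eta b0) ^+ 2 <=
  (\sum_(i < k) hnorm (zeta i - eta i) ^+ 2) / (Num.sqrt a * Num.sqrt b).
Proof.
move=> aE bE; set A := Num.sqrt a; set B := Num.sqrt b.
have A0 : 0 < A by rewrite sqrtr_gt0.
have B0 : 0 < B by rewrite sqrtr_gt0.
have aA : a = A ^+ 2 by rewrite sqr_sqrtr// ltW.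
have bB : b = B ^+ 2 by rewrite sqr_sqrtr// ltW.
pose s t := \sum_(i < k) sqmod (ell2_fun (zeta i) t - ell2_fun (eta i) t).
have [ss sE] : summ s /\ rsum D s = \sum_(i < k) hnorm (zeta i - eta i) ^+ 2.
  have [h1 h2] := @summ_sum k (fun i t => sqmod (ell2_fun (zeta i - eta i) t))
    (fun i => ell2_summ (zeta i - eta i)).
  split => //; rewrite [LHS]h2; apply: eq_bigr => i _; exact: esym (ell2_hnorm2 _).
have [sw wE] := weight_summ zeta; have [sv vE] := weight_summ eta.
rewrite -aE in wE; rewrite -bE in vE.
pose ca := A^-1 ^+ 2 - (A * B)^-1; pose cb := B^-1 ^+ 2 - (A * B)^-1.
rewrite ell2_hnorm2.
apply: (@le_trans _ _ (rsum D (fun t => (A * B)^-1 * s t +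
   (ca * weight zeta t + cb * weight eta t)))).
  apply: le_rsum => [t|t|]; first exact: sqmod_ge0; last first.
    by apply: summD; [exact: summZ|apply: summD; exact: summZ].
  have -> : ell2_fun (ell2_root zeta a0 - ell2_root eta b0) t =
    root_fun zeta a t - root_fun eta b t by [].
  rewrite /root_fun /sqmod /= subr0 expr0n /= addr0.
  rewrite !sqrtrM ?weight_ge0// (sqrtrV (ltW a0)) (sqrtrV (ltW b0)) -/A -/B.
  set p := Num.sqrt (weight zeta t); set q := Num.sqrt (weight eta t).
  have -> : weight zeta t = p ^+ 2 by rewrite sqr_sqrtr// weight_ge0.
  have -> : weight eta t = q ^+ 2 by rewrite sqr_sqrtr// weight_ge0.
  have := sqrt_sum_sqmodB (fun i => ell2_fun (zeta i) t) (fun i => ell2_fun (eta i) t).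
  rewrite -/(weight zeta t) -/(weight eta t) -/p -/q -/(s t) => hs.
  have -> : (p / A - q / B) ^+ 2 = (A * B)^-1 * (p - q) ^+ 2 +
     (ca * p ^+ 2 + cb * q ^+ 2).
    by rewrite /ca /cb; field; rewrite !gt_eqF.
  by rewrite lerD2r ler_pM2l// invr_gt0 mulr_gt0.
rewrite rsumD//; last 2 first.
- exact: summZ.
- by apply: summD; exact: summZ.
rewrite rsumD ?rsumZ//; last 2 first.
- exact: summZ.
- exact: summZ.
rewrite sE wE vE mulrC gerDl.
have -> : ca * a + cb * b = - ((A - B) ^+ 2 / (A * B)).
  by rewrite /ca /cb aA bB; field; rewrite !gt_eqF.
by rewrite oppr_le0 divr_ge0 ?sqr_ge0// ltW// mulr_gt0.
Qed.

Lemma delta_ell2 (t0 : T) : D t0 ->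
  (fun t => (t == t0)%:R : R[i]) \in @ell2_pred R T D.
Proof.
move=> Dt0; apply/asboolP; split.
  by move=> t Dt; case: eqP => // tt0; case: Dt; rewrite tt0.
apply/summP; rewrite (esumID [set t0]).
  rewrite (_ : D `&` [set t0] = [set t0]); last first.
    by apply/seteqP; split => [t []//|t ->].
  rewrite esum_set1// eqxx /= esum1.
    by rewrite adde0 ltry.
  by move=> t [_ /eqP /negPf tt0]; rewrite tt0 /sqmod /= expr0n addr0 normr0.
by move=> t _; rewrite lee_fin.
Qed.

Definition ell2_delta (t0 : T) (Dt0 : D t0) : ell2_space R D := Ell2 (delta_ell2 Dt0).

Lemma hnorm_ell2_delta t0 (Dt0 : D t0) : hnorm (ell2_delta Dt0) = 1.
Proof.
apply/eqP; rewrite -(@eqrXn2 _ 2) ?hnorm_ge0// expr1n -eqe ell2_hnorm2_esum.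
rewrite (esumID [set t0]); last by move=> t _; rewrite lee_fin sqmod_ge0.
rewrite (_ : D `&` [set t0] = [set t0]); last first.
  by apply/seteqP; split => [t []//|t ->].
rewrite esum_set1 /= ?lee_fin ?sqmod_ge0// eqxx /= esum1.
  by rewrite adde0 /sqmod /= expr1n expr0n addr0.
by move=> t [_ /eqP /negPf tt0]; rewrite tt0 /sqmod /= expr0n addr0.
Qed.

End ell2_root.

(** * From weak containment to coamenability *)

Section weakly_contained_coamenable.
Local Open Scope complex_scope.
Variables (R : realType) (d : measure_display) (X : measurableType d).
Variables (mu : probability X R) (Rel S : set (X * X)).
Hypothesis hX : standard_borel X R.
Hypothesis hR : pmp_relation mu Rel.
Hypothesis hS : pmp_relation mu S.

Local Notation qsection := (forall x, quotient_field mu Rel S x).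

Lemma rel_measure_ge_ae (T : set X) (E : set (X * X)) : measurable T ->
  {ae mu, forall x, T x -> exists y, E (x, y)} -> (mu T <= rel_measure mu E)%E.
Proof.
move=> mT [N [mN N0 TN]].
apply: (@le_trans _ _ (mu (T `\` N))); last first.
  apply: rel_measure_ge => [|x [Tx Nx]]; first exact: measurableD.
  by apply: contrapT => nE; apply: Nx; apply: TN => /= /(_ Tx).
rewrite (measureDI mu mT mN) [X in (_ + X)%E](_ : _ = 0%E) ?adde0//.
apply: (subset_measure0 _ mN) => //; exact: measurableI.
Qed.

Section with_group.
Local Open Scope complex_scope.
Variable g : nat -> X -> X.
Hypothesis hg : orbit_enumeration mu Rel g.

Definition mass k (zeta : 'I_k -> qsection) (x : X) : R :=
  \sum_(i < k) hnorm (zeta i x) ^+ 2.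

Definition defect k (zeta : 'I_k -> qsection) (j : nat) (x : X) : R :=
  \sum_(i < k) hnorm (zeta i x - quotient_map hR (enum_rel hg j x) (zeta i (g j x))) ^+ 2.

(** The real part of the sum of the coefficients of the sections at
    (x, [g j x]), written with norms only because norms are already known to
    be measurable; see [coefficientE]. *)
Definition coefficient k (zeta : 'I_k -> qsection) (j : nat) (x : X) : R :=
  2^-1 * (mass zeta x + mass zeta (g j x) - defect zeta j x).

Lemma coefficientE k (zeta : 'I_k -> qsection) j x :
  coefficient zeta j x = complex.Re (\sum_(i < k)
    hdot (quotient_map hR (enum_rel hg j x) (zeta i (g j x))) (zeta i x)).
Proof.
rewrite raddf_sum /coefficient /mass /defect -big_split -sumrB mulr_sumr.
apply: eq_bigr => i _; rewrite hnormB2 quotient_hnorm hdot_sym.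
set h : R[i] := hdot (quotient_map hR (enum_rel hg j x) (zeta i (g j x))) (zeta i x).
rewrite -[RHS]/(complex.Re h).
by case: h => a b /=; field.
Qed.

Lemma ae_real_mass k (zeta : 'I_k -> qsection) :
  (forall i, meas_section (quotient_field mu Rel S) (zeta i)) ->
  ae_real mu (mass zeta).
Proof.
move=> mz; apply: ae_real_sum => i.
exact: (meas_section_hnorm2 hR hS hg (mz i)).
Qed.

Lemma ae_real_coefficient k (zeta : 'I_k -> qsection) j :
  (forall i, meas_section (quotient_field mu Rel S) (zeta i)) ->
  ae_real mu (coefficient zeta j).
Proof.
move=> mz; apply: ae_realM.
  by apply: ae_real_meas; exact: measurable_cst.
apply: ae_realB.
  apply: ae_realD; first exact: ae_real_mass.
  exact: (ae_real_g hX hR hg j (ae_real_mass mz)).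
apply: ae_real_sum => i.
exact: (ae_real_hnorm2_diff hX hR hS hg j (mz i)).
Qed.

Lemma coefficient0 k (zeta : 'I_k -> qsection) x :
  coefficient zeta 0 x = mass zeta x.
Proof.
have g0x : g 0%N x = x by rewrite (enum0 hg).
have E (y : X) (xy : Rel (x, y)) : y = x -> forall i,
    quotient_map hR xy (zeta i y) = zeta i x.
  by move=> yx; subst y => i; exact: val_inj.
rewrite /coefficient /defect big1; last first.
  move=> i _; rewrite (E _ _ g0x) subrr.
  by rewrite hnorm2E linear0l.
by rewrite g0x subr0; field.
Qed.

(** Weak containment applied to the constant section 1 on the union of the
    first N + 1 graphs, a set of measure at most N + 1. *)
Lemma weakly_contained_step (e : R) (N : nat) : 0 < e ->
  weakly_contained (scalar_rep mu Rel) (quotient_rep S hR) ->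
  exists (kz : {k : nat & 'I_k -> qsection}) (T : nat -> set X),
    [/\ forall i, meas_section (quotient_field mu Rel S) (projT2 kz i),
        forall j, measurable (T j),
        forall j, (j <= N)%N -> (mu (T j) <= e%:E)%E &
        {ae mu, forall x, forall j, ~ T j x ->
          `|1 - coefficient (projT2 kz) j x| <= e}].
Proof.
move=> e0 wc.
pose Q : set (X * X) := \bigcup_(j in [set j | (j <= N)%N]) [set z | g j z.1 = z.2].
have mQ : measurable Q.
  apply: bigcup_measurable => j _.
  apply: (measurable_eq_fun hX); last exact: measurable_snd.
  exact: (measurableT_comp (enum_measurable hg j) measurable_fst).
have QR : Q `<=` Rel by move=> [x y] [j _ /= <-]; exact: (enum_rel hg).
have Qfin : (rel_measure mu Q < +oo)%E.
  pose M n : set X := if (n <= N)%N then setT else set0.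
  have mM n : measurable (M n) by rewrite /M; case: ifP.
  apply: (@le_lt_trans _ _ (\sum_(n <oo) mu (M n))%E).
    apply: (@rel_measure_le_series _ _ _ mu hX g) => //.
    apply: aeW => x y [j /= jN xy]; exists j => //; by rewrite /M jN.
  rewrite (nneseries_split _ N.+1); last by move=> n _; exact: measure_ge0.
  rewrite [X in (_ + X)%E]eseries0; last first.
    by move=> n Nn _; rewrite /M leqNgt Nn /= measure0.
  rewrite adde0; apply/lte_sum_pinfty => n _.
  by apply: (le_lt_trans (probability_le1 mu (mM n))); exact: ltry.
have m1 : meas_section (scalar_rep mu Rel) (fun=> 1 : R[i]).
  apply: (@ae_measurable_real _ _ _ mu (fun=> 1)).
  by apply: ae_real_meas; exact: measurable_cst.
have [k [zeta [mz hz]]] := wc Q mQ QR Qfin _ m1 e e0.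
have /choice[T hT] j : exists T, measurable T /\
    {ae mu, forall x, T x <-> e < `|1 - coefficient zeta j x|}.
  have [|T mT hT] := @ae_real_gt _ _ _ mu e (fun x => `|1 - coefficient zeta j x|).
    apply: (@ae_real_comp1 _ _ _ _ (fun a => `|1 - a|)); last exact: ae_real_coefficient.
    by apply: measurableT_comp => //; apply: measurable_funB.
  by exists T.
exists (existT _ k zeta), T; split => //.
- by move=> j; exact: (hT j).1.
- move=> j jN; apply: ltW; apply: le_lt_trans hz; apply: rel_measure_ge_ae.
    exact: (hT j).1.
  apply: filterS (hT j).2 => x hx /hx hc; exists (g j x); split; first by exists j.
  exists (enum_rel hg j x); apply: lt_le_trans (normc_ge_Re _).
  rewrite ltcR [X in `|X|](_ : _ = 1 - coefficient zeta j x)//.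
  rewrite coefficientE raddfB; congr (_ - _).
  by rewrite -[LHS]/(complex.Re (1 * (1 : R[i])^*)) mul1r rmorph1.
have : {ae mu, forall x, forall j, T j x <-> e < `|1 - coefficient zeta j x|}.
  by apply: ae_foralln => j; exact: (hT j).2.
by apply: filterS => x hx j nT /=; rewrite leNgt; apply/negP => /hx.
Qed.

(** Where all the sections vanish there is nothing to normalise, and the class
    of x itself provides a unit vector. *)
Definition root_section k (zeta : 'I_k -> qsection) : qsection := fun x =>
  match pselect (0 < mass zeta x) with
  | left h => ell2_root (zeta ^~ x) h
  | right _ => ell2_delta R (imageP (relclass S) (rel_refl hR x))
  end.

Lemma hnorm_root_section k (zeta : 'I_k -> qsection) x :
  hnorm (root_section zeta x) = 1.
Proof.
rewrite /root_section; case: pselect => h; first exact: hnorm_ell2_root.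
exact: hnorm_ell2_delta.
Qed.

(** The value at a class is a measurable expression in the values of the
    sections and in their mass; the inverse of the mass is written as a power
    because power functions are measurable on the whole line. *)
Lemma meas_root_section k (zeta : 'I_k -> qsection) :
  (forall i, meas_section (quotient_field mu Rel S) (zeta i)) ->
  meas_section (quotient_field mu Rel S) (root_section zeta).
Proof.
move=> mz gamma hgamma; have [mgamma _ _] := hgamma.
have mmass := ae_real_mass mz.
have [T mT hT] := ae_real_gt 0 mmass.
pose w x := \sum_(i < k) sqmod (ell2_fun (zeta i x) (relclass S (gamma x))).
have mw : ae_real mu w.
  by apply: ae_real_sum => i; apply: ae_measurable_sqmod; exact: mz.
pose r x := if `[< T x >] then Num.sqrt (w x * powR (mass zeta x) (- 1))
  else (if `[< S (gamma x, x) >] then 1 else 0).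
have mr : ae_real mu r.
  apply: ae_real_if => //.
    apply: ae_real_comp1.
      by apply: continuous_measurable_fun; exact: sqrt_continuous.
    by apply: ae_realM => //; exact: (ae_real_comp1 (measurable_powR (- 1)) mmass).
  apply: ae_real_if; last 2 first.
  - by apply: ae_real_meas; exact: measurable_cst.
  - by apply: ae_real_meas; exact: measurable_cst.
  exact: (measurable_rel_fun (rel_measurable hS) mgamma (@measurable_id _ _ _)).
have [h mh rh] := ae_measurable_real mr; exists h => //.
apply: filterS2 hT rh => x hTx <-; rewrite /root_section /r.
case: pselect => [h0|h0].
  rewrite asboolT; last exact/hTx.
  by rewrite powR_inv1//; exact: ltW.
rewrite asboolF; last by move/hTx.
rewrite /=; case: asboolP => hSx; first by rewrite (relclass_eq hS hSx) eqxx.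
by case: eqP => // /(relclass_eqP hS).
Qed.

(** The defect is H(x) + H(y) - 2 Re(coefficient), at most 4 e, and the product
    of the square roots of the masses is at least 1/2 because e <= 1/8. *)
Lemma root_section_close k (zeta : 'I_k -> qsection) (e : R) j x : e <= 8^-1 ->
  `|1 - mass zeta x| <= e -> `|1 - mass zeta (g j x)| <= e ->
  `|1 - coefficient zeta j x| <= e ->
  hnorm (root_section zeta x -
    quotient_map hR (enum_rel hg j x) (root_section zeta (g j x))) ^+ 2 <= 8 * e.
Proof.
move=> e8; rewrite !ler_norml => /andP[x1 x2] /andP[y1 y2] /andP[c1 c2].
rewrite /root_section.
case: pselect => [hx|]; last by lra.
case: pselect => [hy|]; last by lra.
have -> : quotient_map hR (enum_rel hg j x) (ell2_root (zeta ^~ (g j x)) hy) =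
  ell2_root (fun i => quotient_map hR (enum_rel hg j x) (zeta i (g j x))) hy.
  exact: val_inj.
have massE : mass zeta (g j x) = \sum_(i < k)
    hnorm (quotient_map hR (enum_rel hg j x) (zeta i (g j x)) : ell2_space R _) ^+ 2.
  by apply: eq_bigr => i _; rewrite quotient_hnorm.
apply: (le_trans (hnorm_ell2_rootB hx hy (erefl _) massE)).
rewrite -/(defect zeta j x).
have dE : defect zeta j x = mass zeta x + mass zeta (g j x) - 2 * coefficient zeta j x.
  by rewrite /coefficient; field.
have s0 : 2^-1 <= Num.sqrt (mass zeta x) * Num.sqrt (mass zeta (g j x)).
  rewrite -sqrtrM; last exact: ltW.
  have -> : 2^-1 = Num.sqrt (2^-1 * 2^-1) :> R by rewrite -expr2 sqrtr_sqr ger0_norm.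
  by rewrite ler_sqrt; [apply: ler_pM => //; lra|apply: mulr_ge0; exact: ltW].
rewrite ler_pdivrMr; last by apply: lt_le_trans s0.
apply: (@le_trans _ _ (8 * e * 2^-1)); first by rewrite dE; lra.
by apply: ler_wpM2l => //; lra.
Qed.

End with_group.

(** At step m the errors are at most [e m] outside sets of measure at most
    [e m], and e is summable.  The graph of index 0 is the diagonal and controls
    the masses, at all the points of a class at once by [ae_saturated]. *)
Lemma weakly_contained_coamenable :
  weakly_contained (scalar_rep mu Rel) (quotient_rep S hR) -> coamenable S hR.
Proof.
move=> wc.
have [g hg] := feldman_moore hX hR.
pose e (m : nat) : R := 4^-1 / (2 ^ m.+1)%:R.
have e0 m : 0 < e m by rewrite divr_gt0// ltr0n expn_gt0.
have /choice[kz] m := weakly_contained_step hg m (e0 m) wc.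
move=> /choice[T hT].
have mz m : forall i, meas_section (quotient_field mu Rel S) (projT2 (kz m) i).
  by have [] := hT m.
exists (fun m => root_section (projT2 (kz m))); split.
- move=> m; split; first exact: (meas_root_section hg).
  under eq_integral do rewrite hnorm_root_section expr1n.
  by rewrite integral_cst// mul1e (le_lt_trans (probability_le1 mu measurableT))// ltry.
- by move=> m; apply: aeW => x; exact: hnorm_root_section.
have hc : {ae mu, forall x, forall m j, ~ T m j x ->
    `|1 - coefficient hg (projT2 (kz m)) j x| <= e m}.
  by apply: ae_foralln => m; have [] := hT m.
have bc : {ae mu, forall x, forall j, exists M, forall m, (M <= m)%N -> ~ T m j x}.
  apply: ae_foralln => j.
  (* The measure of T m j is controlled for j <= m only; dropping finitely many
     sets does not change the limit superior. *)
  pose F m := if (j <= m)%N then T m j else set0.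
  have mF m : measurable (F m) by rewrite /F; case: ifP => // _; have [] := hT m.
  have F0 : mu (lim_sup_set F) = 0%E.
    apply: lim_sup_set_cvg0 => //.
    apply: (@le_lt_trans _ _ (\sum_(m <oo) (e m)%:E)%E).
      apply: lee_nneseries => [m _ _|m _]; first exact: measure_ge0.
      rewrite /F; case: ifP => jm; first by have [_ _ + _] := hT m; apply.
      by rewrite measure0 lee_fin ltW.
    by apply: (le_lt_trans (epsilon_trick0 _ _)) => //; exact: ltry.
  exists (lim_sup_set F); split => //.
    by apply: bigcap_measurableType => n _; exact: bigcup_measurable.
  move=> x /= /forallNP H n _.
  have /existsNP[m /not_implyP[nm /contrapT Tm]] := H (maxn n j).
  exists m => /=; first by rewrite (leq_trans _ nm)// leq_maxl.
  by rewrite /F (leq_trans (leq_maxr n j) nm).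
have close : {ae mu, forall x, forall j, exists M, forall m, (M <= m)%N ->
    `|1 - coefficient hg (projT2 (kz m)) j x| <= e m}.
  apply: filterS2 hc bc => x hcx bcx j; have [M hM] := bcx j.
  by exists M => m Mm; apply: hcx; exact: hM.
have closemass : {ae mu, forall x, forall y, Rel (x, y) -> exists M, forall m,
    (M <= m)%N -> `|1 - mass (projT2 (kz m)) y| <= e m}.
  apply: (ae_saturated hX hR); apply: filterS close => x /(_ 0%N)[M hM].
  by exists M => m /hM; rewrite coefficient0.
apply: ae_rel_of_ae.
apply: filterS2 (enum_cover hg) (filterI close closemass) => x hx [hcl hm] y xy /=.
have [j yj] := hx y xy; subst y.
have -> : xy = enum_rel hg j x by exact: Prop_irrelevance.
have [M1 h1] := hcl j; have [M2 h2] := hm _ (rel_refl hR x); have [M3 h3] := hm _ xy.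
have e8 m : e m <= 8^-1.
  rewrite /e ler_pdivrMr ?ltr0n ?expn_gt0// expnS natrM.
  have : (1 : R) <= (2 ^ m)%:R by rewrite ler1n expn_gt0.
  lra.
apply/cvgrPdist_lt => eps eps0.
have : \forall m \near \oo, (2^-1 : R) ^+ m < eps ^+ 2.
  apply: (cvgr_lt 0); last by rewrite exprn_gt0.
  by apply: cvg_expr; rewrite ger0_norm// invf_lt1// ltr1n.
move=> [M4 _ h4]; exists (maxn (maxn M1 M2) (maxn M3 M4)) => // m /=.
rewrite !geq_max => /andP[/andP[m1 m2] /andP[m3 m4]].
rewrite sub0r normrN ger0_norm ?hnorm_ge0//.
rewrite -(@ltr_pXn2r _ 2) ?nnegrE ?hnorm_ge0 ?(ltW eps0)//.
apply: le_lt_trans (h4 m m4).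
have := @root_section_close g hg _ (projT2 (kz m)) (e m) j x (e8 m) (h2 m m2)
  (h3 m m3) (h1 m m1).
move/le_trans; apply.
rewrite /e expnS natrM natrX exprVn invfM.
set a := (2 ^+ m)^-1; lra.
Qed.

End weakly_contained_coamenable.

Theorem proposition4p6 (R : realType) (d : measure_display)
    (X : measurableType d) (mu : probability X R) (Rel S : set (X * X))
    (hX : standard_borel X R)
    (hR : pmp_relation mu Rel) (hS : pmp_relation mu S) (hSR : S `<=` Rel) :
  coamenable S hR <->
  weakly_contained (scalar_rep mu Rel) (quotient_rep S hR).
Proof.
split; first exact: coamenable_weakly_contained.
exact: weakly_contained_coamenable.
Qed.
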